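(* Let $V$ be a real inner-product space of finite dimension $d\ge1$, let $U$ be an abelian group with a translation-invariant ultrametric, let $\Lambda\subset V\times U$ be a closed additive subgroup, and let $X=(V\times U)/\Lambda$ carry the quotient metric induced by the maximum product metric. Suppose that the effective real dimension satisfies $m_\Lambda\in\{1,2\}$. Then for every $\alpha\in X$, with strict best-return denominators $q_1<q_2<\cdots$, $$q_{n+2^{m_\Lambda}+1}>q_n+q_{n+1}$$ for every $n\ge1$ for which the left-hand side is defined. Moreover, in both effective dimensions the index $2^{m_\Lambda}+1$ cannot be replaced by $2^{m_\Lambda}$, even if the conclusion is weakened to a non-strict inequality: for each $m\in\{1,2\}$ there exist a real inner-product space $V$ of finite dimension at least $1$, an abelian group $U$ with a translation-invariant ultrametric, and a closed additive subgroup $\Lambda\subset V\times U$ with $m_\Lambda=m$, together with an element $\alpha\in X=(V\times U)/\Lambda$ (where $X$ carries the quotient metric induced by the maximum product metric) and an index $n\ge1$, such that the strict best-return denominators of $\alpha$ have $q_{n+2^{m}}$ defined and $q_{n+2^{m}}<q_n+q_{n+1}$.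
   Context: Metric setting. Write the ultrametric on $U$ as $d_U(u,w)=|u-w|_U$, so $|u+w|_U\le\max\{|u|_U,|w|_U\}$. On $V\times U$ put $|(v,u)|=\max\{\|v\|_V,|u|_U\}$, where $\|\cdot\|_V$ is the norm induced by the inner product; ''closed'' refers to the induced metric topology. On $X=(V\times U)/\Lambda$ put $\|a+\Lambda\|_X=\inf_{\lambda\in\Lambda}|a-\lambda|$ and $d_X(x,y)=\|x-y\|_X$. The infimum need not be attained. Best returns. For positive integers $q$ put $\rho(q)=d_X(q\alpha,0)$. The strict best-return denominators of $\alpha$ are $q_1=1$ and $q_{n+1}=\min\{q>q_n:\rho(q)<\rho(q_n)\}$ as long as such $q$ exists; the sequence may terminate, and a zero return (if any) is retained as its final term. Effective real dimension. $W=\{v\in V:(tv,0)\in\Lambda\text{ for every }t\in\mathbb R\}$; $\pi:V\to W^\perp$ is orthogonal projection; $E_\Lambda=\operatorname{span}_{\mathbb R}\{\pi(v):(v,u)\in\Lambda\}$; $m_\Lambda=\dim E_\Lambda$. *)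

(* Defs.v *)
From HB Require Import structures.
From mathcomp Require Import all_boot all_order all_algebra.
From mathcomp Require Import sesquilinear.
From mathcomp Require Import all_classical all_reals.

Set Implicit Arguments.
Unset Strict Implicit.
Unset Printing Implicit Defensive.

Import Order.TTheory GRing.Theory Num.Theory.
Import Quotient.

Local Open Scope classical_set_scope.
Local Open Scope ring_scope.
Local Open Scope quotient_scope.

Record invariant_ultrametric (R : realType) (U : zmodType) (dU : U -> U -> R) :
    Prop := InvariantUltrametric {
  umet_ge0 : forall u w, 0 <= dU u w ;
  umet_eq0 : forall u w, dU u w = 0 <-> u = w ;
  umet_sym : forall u w, dU u w = dU w u ;
  umet_ultra : forall u x w, dU u w <= Num.max (dU u x) (dU x w) ;
  umet_transl : forall x u w, dU (u + x) (w + x) = dU u w }.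

Section LinearSpan.
Context {R : realType} {V : vectType R}.
Implicit Types A : set V.

Definition spanned_by A (v : V) : Prop :=
  exists2 s : seq V, (forall x, x \in s -> A x) & v \in <<s>>%VS.

(* The default 0%VS is never used, by mem_set_span. *)
Definition set_span A : {vspace V} :=
  xget 0%VS [set E : {vspace V} | forall v, v \in E <-> spanned_by A v].

Lemma mem_set_span A v : v \in set_span A <-> spanned_by A v.
Proof.
rewrite /set_span; case: xgetP => [E _ //|noE].
exfalso.
pose P k := `[< exists2 s : seq V, (forall x, x \in s -> A x) &
                \dim <<s>>%VS = k >].
have exP : exists k, P k.
  by exists (\dim <<[::] : seq V>>%VS); apply/asboolP; exists [::].
have ubP k : P k -> (k <= \dim {:V})%N.
  by move=> /asboolP[s _ <-]; apply: dimvS; exact: subvf.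
case: (ex_maxnP exP ubP) => k /asboolP[s As <-] smax.
apply: (noE <<s>>%VS) => w; split=> [ws|[t At wt]]; first by exists s.
have Ast x : x \in s ++ t -> A x by rewrite mem_cat => /orP[/As|/At].
have sst : (<<s>> <= <<s ++ t>>)%VS by rewrite span_cat addvSl.
have /eqP <- : <<s ++ t>>%VS == <<s>>%VS.
  rewrite eq_sym eqEdim sst /=; apply: smax.
  by apply/asboolP; exists (s ++ t).
by rewrite span_cat (subvP (addvSr _ _)).
Qed.

End LinearSpan.

Section Setting.
Context {R : realType} {V : vectType R} {U : zmodType}.
Variables (ip : {dot V for @idfun R}) (dU : U -> U -> R).

Definition ipnorm (v : V) : R := Num.sqrt (ip v v).

Definition pnorm (a : V * U) : R := Num.max (ipnorm a.1) (dU a.2 0).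

(* Subgroups are boolean predicates; with the classical axioms of boolp every
   subgroup given as a Prop-valued set is of this form. *)
Variable L : zmodClosed (V * U)%type.

Definition closed_subgroup : Prop :=
  forall a, (forall e, 0 < e -> exists2 l, l \in L & pnorm (a - l) < e) ->
  a \in L.

(* {quot L} is (V * U) / L. *)
Definition qnorm (x : {quot L}) : R :=
  inf [set r | exists2 l, l \in L & r = pnorm (repr x - l)].

(* qnorm does not depend on the representative. *)
Lemma qnormE (a : V * U) :
  qnorm (\pi a) = inf [set r | exists2 l, l \in L & r = pnorm (a - l)].
Proof.
have aL : a - repr (\pi_{quot L} a) \in L.
  by rewrite (idealrBE L) reprK.
rewrite /qnorm; congr inf; apply/seteqP; split=> r [l lL ->].
  exists (a - repr (\pi_{quot L} a) + l); first exact: rpredD.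
  by rewrite opprD addrA subKr.
exists (l - (a - repr (\pi_{quot L} a))); first exact: rpredB.
by rewrite opprB addrA [_ + (a - _)]addrC subrK.
Qed.

Definition qdist (x y : {quot L}) : R := qnorm (x - y).

Definition return_dist (alpha : {quot L}) (q : nat) : R :=
  qdist (alpha *+ q) 0.

(* best_denom alpha n q: the n-th strict best-return denominator (n >= 1) of
   alpha is defined and equal to q. *)
Inductive best_denom (alpha : {quot L}) : nat -> nat -> Prop :=
| best_denom1 : best_denom alpha 1 1
| best_denomS n q q' :
    best_denom alpha n q ->
    (q < q')%N -> return_dist alpha q' < return_dist alpha q ->
    (forall p, (q < p)%N -> return_dist alpha p < return_dist alpha q ->
      (q' <= p)%N) ->
    best_denom alpha n.+1 q'.

(* The set below is already a linear subspace (mem_lineality), so taking its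
   span only gives it the type {vspace V}. *)
Definition lineality : {vspace V} :=
  set_span [set v | forall t : R, (t *: v, 0) \in L].

Lemma mem_lineality v :
  v \in lineality <-> forall t : R, (t *: v, 0) \in L.
Proof.
split=> [/mem_set_span[s sL] vs t|vL]; last first.
  apply/mem_set_span; exists [:: v]; last by rewrite memv_span1.
  by move=> x; rewrite inE => /eqP->.
rewrite (@coord_span _ _ _ (in_tuple s) _ vs) scaler_sumr.
elim/big_rec: _ => [|i w _ wL]; first by rewrite (rpred0 L).
rewrite scalerA.
have -> : (((t * coord (in_tuple s) i v) *: (in_tuple s)`_i + w, 0) : V * U) =
   ((t * coord (in_tuple s) i v) *: (in_tuple s)`_i, 0) + (w, 0).
  by congr pair; rewrite addr0.
by rewrite rpredD// sL// mem_nth.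
Qed.

(* daddv_pi A B is the projection onto A along B. *)
Definition perp_proj : 'End(V) := daddv_pi (orthov ip lineality) lineality.

Lemma perp_projP v :
  perp_proj v \in orthov ip lineality /\ v - perp_proj v \in lineality.
Proof.
set W := lineality; set P := orthov ip W.
have capPW : (P :&: W = 0)%VS.
  apply/eqP; rewrite -subv0; apply/subvP => w /memv_capP[/mem_orthovP wP wW].
  rewrite memv0; apply/eqP; apply: contrapT => /eqP w0.
  by have := @neq0_dnorm_gt0 _ _ _ ip w w0; rewrite wP// ltxx.
have addPW : (P + W = fullv)%VS.
  apply/eqP; rewrite eqEdim subvf dimv_disjoint_sum//=.
  pose f (x : V) : 'rV[R]_(\dim W) := \row_i ip x (vbasis W)`_i.
  have linf : linear f.
    by move=> a x y; apply/rowP => i; rewrite !mxE linearPl.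
  pose F := linfun (HB.pack f (GRing.isLinear.Build _ _ _ _ f linf) :
    {linear V -> 'rV[R]_(\dim W)}).
  have kerF : (lker F <= P)%VS.
    apply/subvP => x; rewrite memv_ker lfunE/= => /eqP fx0.
    apply/mem_orthovP => y /coord_vbasis ->.
    rewrite linear_sumr big1// => i _; rewrite linearZr/=.
    by move/rowP : fx0 => /(_ i); rewrite !mxE => ->; rewrite mulr0.
  rewrite -(limg_ker_dim F fullv) capfv leq_add ?dimvS//.
  by rewrite (leq_trans (dimvS (subvf _)))// dimvf /dim/= mul1n.
split; first exact: memv_pi.
have vPW : v \in (P + W)%VS by rewrite addPW memvf.
by rewrite -{1}(daddv_pi_add capPW vPW) addrAC subrr add0r memv_pi.
Qed.

Definition eff_span : {vspace V} :=
  set_span [set w | exists2 a : V * U, a \in L & w = perp_proj a.1].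

Definition eff_dim : nat := \dim eff_span.

End Setting.

(* Main.v *)
Require Import Defs.
From HB Require Import structures.
From mathcomp Require Import all_boot all_order all_algebra.
From mathcomp Require Import sesquilinear.
From mathcomp Require Import all_classical all_reals.
From mathcomp Require Import ring lra zify.

Set Implicit Arguments.
Unset Strict Implicit.
Unset Printing Implicit Defensive.

Import Order.TTheory GRing.Theory Num.Theory.
Import Quotient.

Local Open Scope ring_scope.

(* Let r be the return of q_n and Q = q_(n+1). Lift the returns of q_(n+1),
   ..., q_(n+2^m+1) to V x U with norm below r. By the ultrametric inequality
   the U-part of every integer combination of the lifts is below r, so a
   combination whose q-value k satisfies 0 < |k| < Q has V-part at least r.
   Splitting off the component orthogonal to E (which is proportional to k, and
   |k| < Q <= q_i) gives the same alternative for vectors w_i of E, with r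
   replaced by a smaller radius. If q_(n+2^m+1) <= q_n + q_(n+1), all
   differences of the q_i are below Q, so the w_i are separated by the radius.
   A line cannot contain three such points.
   In the plane the five w_i are the vertices of a pentagon around the origin,
   since no closed half plane bounded by a line through the origin and one w_i
   contains four of them (two of them would make an angle at most 60 degrees).
   By a convexity argument valid in any norm, w_0 - w_1 + w_2 - w_3 is short for
   any four consecutive vertices. So each q_0 - q_1 + q_2 - q_3 vanishes or is
   at least Q in absolute value; two consecutive such sums add up to a
   difference of two q's, nonzero and below Q, hence they have opposite signs,
   which is impossible around a cycle of odd length.
   For sharpness, take U = Z/2 with the discrete metric of value r and
   L = {(i e + j f, j mod 2)} in R^2 x U:
   e = 0, f = (14, 0), alpha = (6, 0), r = 5 has best returns 1, 2, 4, 5, and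
   e = (-13, 5), f = (0, 13), alpha = (7, 20), r = 6 has 1, 4, 6, 7, 8, 9. *)

(** * Four points of an absolutely convex planar set *)

Section AbsolutelyConvex.
Context {R : realFieldType}.
Implicit Types (B : R -> R -> Prop).

(** A predicate on coordinates rather than on vectors: below it is a disc read in an oblique
    basis. *)
Definition absolutely_convex B := forall a b c d s t : R,
  B a b -> B c d -> `|s| + `|t| <= 1 -> B (s * a + t * c) (s * b + t * d).

Lemma absolutely_convex_mix B : absolutely_convex B -> forall a b c d s t e f,
  B a b -> B c d -> `|s| + `|t| <= 1 ->
  e = s * a + t * c -> f = s * b + t * d -> B e f.
Proof. by move=> cB a b c d s t e f ab cd st -> ->; exact: cB. Qed.

Lemma absolutely_convexN B a b : absolutely_convex B -> B a b -> B (- a) (- b).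
Proof.
move=> cB Bab; apply: (absolutely_convex_mix cB Bab Bab (s := -1) (t := 0)).
- by rewrite normrN normr1 normr0 addr0.
- by ring.
- by ring.
Qed.

(* A + C = P + Q with A in the parallelogram spanned by P and Q: one of A, C
   lies in the triangle 0PQ. *)
Lemma parallelogram B (p1 p2 q1 q2 a1 a2 l m : R) :
  absolutely_convex B -> B p1 p2 -> B q1 q2 ->
  0 <= l <= 1 -> 0 <= m <= 1 ->
  a1 = l * p1 + m * q1 -> a2 = l * p2 + m * q2 -> ~ B a1 a2 ->
  B (p1 + q1 - a1) (p2 + q2 - a2).
Proof.
move=> cB Bp Bq /andP[l0 l1] /andP[m0 m1] -> -> nB.
have [lm|/ltW lm] := leP (l + m) 1.
  by case: nB; apply: cB => //; rewrite !ger0_norm.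
apply: (absolutely_convex_mix cB Bp Bq (s := 1 - l) (t := 1 - m)).
- by rewrite !ger0_norm; lra.
- by ring.
- by ring.
Qed.

(** Otherwise an excluded point lies in a triangle with one vertex 0 and the other two in [B]. If x1
    < y1 <= 1, it is (x1, y1 - 1), with vertices (1, 0), (0, -1); if x1 <= 1 < y1, it is (x1, y1 -
    1), with vertices (1, 0), (x1, y1); if both exceed 1, it is (1, 1), with vertices (x1, y1) and a
    basis vector. *)
Lemma outer_slope B (x1 y1 : R) : absolutely_convex B ->
  B 1 0 -> B 0 1 -> B x1 y1 -> 0 <= x1 -> 0 <= y1 ->
  ~ B 1 1 -> ~ B x1 (y1 - 1) -> y1 <= 1 /\ y1 <= x1.
Proof.
move=> cB B10 B01 Bx x0 y0 n11 nxv.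
have [y1_le1|y1_gt1] := leP y1 1.
  split=> //; rewrite leNgt; apply/negP => x_lt_y; apply: nxv.
  apply: (absolutely_convex_mix cB B10 B01 (s := x1) (t := y1 - 1));
    [|by ring..].
  by rewrite ger0_norm// ler0_norm; lra.
exfalso; have [x1_le1|x1_gt1] := leP x1 1.
  have yn0 : y1 != 0 by rewrite gt_eqF//; lra.
  apply: nxv.
  apply: (absolutely_convex_mix cB Bx B10 (s := 1 - y1^-1) (t := x1 / y1));
    [|by field|by field].
  rewrite !ger0_norm; first last.
  - by rewrite subr_ge0 invf_le1; lra.
  - by rewrite divr_ge0.
  - have -> : 1 - y1^-1 + x1 / y1 = 1 - (1 - x1) / y1 by field.
    by rewrite lerBlDr lerDl divr_ge0; lra.
apply: n11; have xn0 : x1 != 0 by rewrite gt_eqF//; lra.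
have yn0 : y1 != 0 by rewrite gt_eqF//; lra.
have [yx|/ltW xy] := leP y1 x1.
  apply: (absolutely_convex_mix cB Bx B01 (s := x1^-1) (t := (x1 - y1) / x1));
    [|by field|by field].
  rewrite !ger0_norm; first last.
  - by rewrite invr_ge0.
  - by rewrite divr_ge0; lra.
  - have -> : x1^-1 + (x1 - y1) / x1 = 1 - (y1 - 1) / x1 by field.
    by rewrite lerBlDr lerDl divr_ge0; lra.
apply: (absolutely_convex_mix cB Bx B10 (s := y1^-1) (t := (y1 - x1) / y1));
    [|by field|by field].
rewrite !ger0_norm; first last.
- by rewrite invr_ge0.
- by rewrite divr_ge0; lra.
- have -> : y1^-1 + (y1 - x1) / y1 = 1 - (x1 - 1) / y1 by field.
  by rewrite lerBlDr lerDl divr_ge0; lra.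
Qed.

Lemma absolutely_convex_swap B :
  absolutely_convex B -> absolutely_convex (fun a b => B b a).
Proof. by move=> cB a b c d s t; exact: cB. Qed.

(** [parallelogram] with P = (-1, 0), Q = (x2, y2) and A = (-x1, 1 - y1), excluded by symmetry; the
    bound on x1 * y2 - x2 * y1 keeps the coefficient of P at most 1. *)
Lemma four_points_steep B (x1 y1 x2 y2 : R) : absolutely_convex B ->
  B 1 0 -> B x2 y2 ->
  0 <= x1 -> 0 <= x2 -> y1 <= 1 -> y1 <= x1 -> 1 < y1 + y2 ->
  0 <= y2 -> x1 * y2 - x2 * y1 < y2 - x2 -> ~ B x1 (y1 - 1) ->
  B (1 - x1 - x2) (1 - y1 - y2).
Proof.
move=> cB B10 By x10 x20 y11 yx1 yy y20 lD nxv.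
have y2p : 0 < y2 by lra.
have yn0 : y2 != 0 by rewrite gt_eqF.
have -> : 1 - x1 - x2 = - (-1 + x2 - - x1) by ring.
have -> : 1 - y1 - y2 = - (- 0 + y2 - (1 - y1)) by ring.
apply: absolutely_convexN => //.
have BN : B (-1) (- 0) by apply: absolutely_convexN.
apply: (parallelogram cB BN By
  (l := x1 + x2 * (1 - y1) / y2) (m := (1 - y1) / y2)).
- apply/andP; split; first by rewrite addr_ge0// divr_ge0// mulr_ge0//; lra.
  have -> : x1 + x2 * (1 - y1) / y2 = (x1 * y2 + x2 * (1 - y1)) / y2 by field.
  by rewrite ler_pdivrMr//; lra.
- by apply/andP; split; [rewrite divr_ge0//; lra|rewrite ler_pdivrMr//; lra].
- by field.
- by field.
- move=> Bn; apply: nxv; rewrite -[x1]opprK -[y1 - 1]opprK opprB.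
  exact: absolutely_convexN.
Qed.

(** Let u, v be the basis vectors and x, y the other two points. Up to sign, u + v - x - y is the
    point C of [parallelogram] in four ways: with A = x + y spanned by u, v; A = v - x by -u, y; A =
    u - y by -v, x; A = u + v by x, y. The determinant and the coordinate sums decide which one
    applies. *)
Lemma four_points_convex B (x1 y1 x2 y2 : R) : absolutely_convex B ->
  B 1 0 -> B 0 1 -> B x1 y1 -> B x2 y2 ->
  0 <= x1 -> 0 <= y1 -> 0 <= x2 -> 0 <= y2 -> 0 < x1 * y2 - x2 * y1 ->
  ~ B 1 1 -> ~ B x1 (y1 - 1) -> ~ B (x2 - 1) y2 -> ~ B (x1 + x2) (y1 + y2) ->
  B (1 - x1 - x2) (1 - y1 - y2).
Proof.
move=> cB B10 B01 Bx By x10 y10 x20 y20 D0 n11 nxv nyu nxy.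
have [y1_le1 yx1] := outer_slope cB B10 B01 Bx x10 y10 n11 nxv.
have [x2_le1 xy2] :=
  outer_slope (absolutely_convex_swap cB) B01 B10 By y20 x20 n11 nyu.
pose D := x1 * y2 - x2 * y1.
have Dn0 : D != 0 by rewrite gt_eqF.
(* This says that u + v has a coefficient above 1 on x in the basis x, y. *)
have [lD|lD] := ltP D (y2 - x2).
  have [yy|yy] := ltP 1 (y1 + y2); first exact: four_points_steep.
  have [xx|xx] := leP (x1 + x2) 1.
    have := parallelogram cB B10 B01 (l := x1 + x2) (m := y1 + y2) _ _ _ _ nxy.
    have -> : 1 - x1 - x2 = 1 + 0 - (x1 + x2) by ring.
    have -> : 1 - y1 - y2 = 0 + 1 - (y1 + y2) by ring.
    by apply; [apply/andP; split; lra|apply/andP; split; lra|ring|ring].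
  have h1 : 0 <= x2 * (1 - y1 - y2) by apply: mulr_ge0; lra.
  have h2 : 0 <= y2 * (x1 + x2 - 1) by apply: mulr_ge0; lra.
  by exfalso; rewrite /D in lD; lra.
have [mD|mD] := ltP D (x1 - y1).
  have [xx|xx] := ltP 1 (x1 + x2).
    have := four_points_steep (absolutely_convex_swap cB) B01 Bx y20 y10
      x2_le1 xy2 _ x10 _ nyu.
    have -> : 1 - x1 - x2 = 1 - x2 - x1 by ring.
    have -> : 1 - y1 - y2 = 1 - y2 - y1 by ring.
    by apply; rewrite /D in mD; lra.
  have [yy|yy] := leP (y1 + y2) 1.
    have := parallelogram cB B10 B01 (l := x1 + x2) (m := y1 + y2) _ _ _ _ nxy.
    have -> : 1 - x1 - x2 = 1 + 0 - (x1 + x2) by ring.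
    have -> : 1 - y1 - y2 = 0 + 1 - (y1 + y2) by ring.
    by apply; [apply/andP; split; lra|apply/andP; split; lra|ring|ring].
  have h1 : 0 <= y1 * (1 - x1 - x2) by apply: mulr_ge0; lra.
  have h2 : 0 <= x1 * (y1 + y2 - 1) by apply: mulr_ge0; lra.
  by exfalso; rewrite /D in mD; lra.
have -> : 1 - x1 - x2 = - (x1 + x2 - 1) by ring.
have -> : 1 - y1 - y2 = - (y1 + y2 - 1) by ring.
apply: absolutely_convexN => //.
apply: (parallelogram cB Bx By (l := (y2 - x2) / D) (m := (x1 - y1) / D)) => //.
- rewrite ler_pdivrMr// mul1r lD andbT divr_ge0//; last exact: ltW.
  by rewrite subr_ge0.
- rewrite ler_pdivrMr// mul1r mD andbT divr_ge0//; last exact: ltW.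
  by rewrite subr_ge0.
- by rewrite /D; field; exact: Dn0.
- by rewrite /D; field; exact: Dn0.
Qed.

End AbsolutelyConvex.

(** * Planar notation and a sign argument on a cycle *)

Definition sqnorm2 {R : pzRingType} (p : R * R) : R := p.1 ^+ 2 + p.2 ^+ 2.
Definition cross {R : pzRingType} (p q : R * R) : R := p.1 * q.2 - p.2 * q.1.

Lemma normr_dot_le {R : realFieldType} (a b c d : R) :
  `|2 * (a * c + b * d)| <= a ^+ 2 + b ^+ 2 + (c ^+ 2 + d ^+ 2).
Proof.
have hD : 0 <= (a + c) ^+ 2 + (b + d) ^+ 2 by rewrite addr_ge0 ?sqr_ge0.
have hB : 0 <= (a - c) ^+ 2 + (b - d) ^+ 2 by rewrite addr_ge0 ?sqr_ge0.
by rewrite ler_norml; apply/andP; split; lra.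
Qed.

(** If a term vanished or both had the same sign, the sum would be 0 or at least Q in absolute
    value. *)
Lemma opposite_signs (Q x y : int) : [\/ x = 0, Q <= x | x <= - Q] ->
  [\/ y = 0, Q <= y | y <= - Q] -> x + y != 0 -> `|x + y| < Q ->
  (Q <= x /\ y <= - Q) \/ (x <= - Q /\ Q <= y).
Proof. by case=> ?; case=> ? ? ?; lia. Qed.

Lemma no_odd_cycle (Q x0 x1 x2 x3 x4 : int) :
  let far x := [\/ x = 0, Q <= x | x <= - Q] in
  let near x := x != 0 /\ `|x| < Q in
  far x0 -> far x1 -> far x2 -> far x3 -> far x4 ->
  near (x0 + x1) -> near (x1 + x2) -> near (x2 + x3) -> near (x3 + x4) ->
  near (x4 + x0) -> False.
Proof.
move=> far near f0 f1 f2 f3 f4.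
move=> [n01 m01] [n12 m12] [n23 m23] [n34 m34] [n40 m40].
have Q0 : 0 < Q by exact: le_lt_trans (normr_ge0 _) m01.
have := opposite_signs f0 f1 n01 m01; have := opposite_signs f1 f2 n12 m12.
have := opposite_signs f2 f3 n23 m23; have := opposite_signs f3 f4 n34 m34.
have := opposite_signs f4 f0 n40 m40; clear -Q0.
by case=> -[? ?] [[? ?]|[? ?]] [[? ?]|[? ?]] [[? ?]|[? ?]] [[? ?]|[? ?]]; lia.
Qed.

(** * Separated points in the Euclidean plane *)

Section Plane.
Context {R : rcfType}.
Implicit Types (p q u v w : R * R) (s : R).

Lemma sqnorm2_ge0 p : 0 <= sqnorm2 p.
Proof. by rewrite addr_ge0 ?sqr_ge0. Qed.

(** With X = |x| and Y = |y|, the squared norm of the combination is at most (X + Y) * (X * P + Y *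
    Q), hence at most X * P + Y * Q, where P and Q are below s. *)
Lemma sqnorm2_absolutely_convex u v s : 0 < s ->
  absolutely_convex
    (fun a b => sqnorm2 (a * u.1 + b * v.1, a * u.2 + b * v.2) < s).
Proof.
move=> s0 a b c d x y; rewrite /sqnorm2 /=.
set p1 := a * u.1 + b * v.1; set p2 := a * u.2 + b * v.2.
set q1 := c * u.1 + d * v.1; set q2 := c * u.2 + d * v.2 => ps qs xy.
have -> : (x * a + y * c) * u.1 + (x * b + y * d) * v.1 = x * p1 + y * q1.
  by rewrite /p1 /q1; ring.
have -> : (x * a + y * c) * u.2 + (x * b + y * d) * v.2 = x * p2 + y * q2.
  by rewrite /p2 /q2; ring.
clearbody p1 p2 q1 q2.
set P := p1 ^+ 2 + p2 ^+ 2 in ps *; set Q := q1 ^+ 2 + q2 ^+ 2 in qs *.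
have P0 : 0 <= P by rewrite addr_ge0 ?sqr_ge0.
have Q0 : 0 <= Q by rewrite addr_ge0 ?sqr_ge0.
have pq : `|x * y * (2 * (p1 * q1 + p2 * q2))| <= `|x| * `|y| * (P + Q).
  rewrite normrM [`|x * y|]normrM ler_wpM2l ?mulr_ge0//.
  exact: normr_dot_le.
have {}pq := le_trans (ler_norm _) pq.
have xx : x ^+ 2 = `|x| ^+ 2 by rewrite real_normK// num_real.
have yy : y ^+ 2 = `|y| ^+ 2 by rewrite real_normK// num_real.
have -> : (x * p1 + y * q1) ^+ 2 + (x * p2 + y * q2) ^+ 2 =
  `|x| ^+ 2 * P + `|y| ^+ 2 * Q + x * y * (2 * (p1 * q1 + p2 * q2)).
  by rewrite -xx -yy /P /Q; ring.
move: xy (normr_ge0 x) (normr_ge0 y) pq.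
move: `|x| `|y| (x * y * _) => X Y Z XY X0 Y0 Zb.
have h1 : 0 <= (1 - X - Y) * (X * P + Y * Q).
  by apply: mulr_ge0; [lra|apply: addr_ge0; exact: mulr_ge0].
have h2 : X * P + Y * Q < s.
  have h3 : 0 <= X * (s - P) by apply: mulr_ge0; lra.
  have h4 : 0 <= Y * (s - Q) by apply: mulr_ge0; lra.
  (* Strictness comes from 1 - X - Y > 0 or, if X + Y = 1, from a positive weight. *)
  have [XY1|XY1] := ltP (X + Y) 1.
    have h5 : 0 < s * (1 - X - Y) by apply: mulr_gt0; lra.
    lra.
  have [Xp|Xp] := ltP 0 X.
    have h5 : 0 < X * (s - P) by apply: mulr_gt0; lra.
    have e : Y = 1 - X by lra.
    by rewrite e in h4 *; lra.
  have -> : X = 0 by lra.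
  have -> : Y = 1 by lra.
  lra.
lra.
Qed.

(** [four_points_convex] for the disc in the basis -w2, w1: up to sign, its four excluded points are
    the differences of cyclic neighbours, and its conclusion is about the alternating sum. The cross
    products give the signs of the coordinates and of the determinant. *)
Lemma alternating_sum_small (w0 w1 w2 w3 : R * R) s :
  sqnorm2 w0 < s -> sqnorm2 w1 < s -> sqnorm2 w2 < s -> sqnorm2 w3 < s ->
  s <= sqnorm2 (w0 - w1) -> s <= sqnorm2 (w1 - w2) ->
  s <= sqnorm2 (w2 - w3) -> s <= sqnorm2 (w3 - w0) ->
  0 < cross w0 w1 -> 0 < cross w0 w2 -> 0 < cross w1 w2 ->
  0 < cross w1 w3 -> 0 < cross w2 w3 -> 0 < cross w3 w0 ->
  sqnorm2 (w0 - w1 + w2 - w3) < s.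
Proof.
case: w0 w1 w2 w3 => [a0 b0] [a1 b1] [a2 b2] [a3 b3].
move=> w0s w1s w2s w3s d01 d12 d23 d30 c01 c02 c12 c13 c23 c30.
have s0 : 0 < s by exact: le_lt_trans (sqnorm2_ge0 _) w0s.
rewrite /sqnorm2 /cross /= in w0s w1s w2s w3s d01 d12 d23 d30
  c01 c02 c12 c13 c23 c30 *.
set d := a1 * b2 - b1 * a2 in c12.
have dn0 : d != 0 by rewrite gt_eqF.
(* w0 and -w3 have coordinates (x1, y1), (x2, y2) >= 0 in the basis -w2, w1. *)
pose x1 := (a0 * b1 - b0 * a1) / d; pose y1 := (a0 * b2 - b0 * a2) / d.
pose x2 := (a1 * b3 - b1 * a3) / d; pose y2 := (a2 * b3 - b2 * a3) / d.
have ea0 : x1 * - a2 + y1 * a1 = a0 by rewrite /x1 /y1 /d; field; exact: dn0.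
have eb0 : x1 * - b2 + y1 * b1 = b0 by rewrite /x1 /y1 /d; field; exact: dn0.
have ea3 : x2 * - a2 + y2 * a1 = - a3 by rewrite /x2 /y2 /d; field; exact: dn0.
have eb3 : x2 * - b2 + y2 * b1 = - b3 by rewrite /x2 /y2 /d; field; exact: dn0.
have x10 : 0 <= x1 by rewrite ltW// divr_gt0.
have y10 : 0 <= y1 by rewrite ltW// divr_gt0.
have x20 : 0 <= x2 by rewrite ltW// divr_gt0.
have y20 : 0 <= y2 by rewrite ltW// divr_gt0.
have D0 : 0 < x1 * y2 - x2 * y1.
  have -> : x1 * y2 - x2 * y1 = (a3 * b0 - b3 * a0) / d.
    by rewrite /x1 /y1 /x2 /y2 /d; field; exact: dn0.
  by rewrite divr_gt0.
have := four_points_convex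
  (@sqnorm2_absolutely_convex (- a2, - b2) (a1, b1) s s0) _ _ _ _
  x10 y10 x20 y20 D0.
rewrite /sqnorm2 /=.
have -> : (1 - x1 - x2) * - a2 + (1 - y1 - y2) * a1 = - (a0 - a1 + a2 - a3).
  by rewrite -ea0 -[a3]opprK -ea3; ring.
have -> : (1 - x1 - x2) * - b2 + (1 - y1 - y2) * b1 = - (b0 - b1 + b2 - b3).
  by rewrite -eb0 -[b3]opprK -eb3; ring.
rewrite !sqrrN; apply; rewrite ?ea0 ?eb0 ?ea3 ?eb3.
- lra.
- lra.
- done.
- lra.
- apply/negP; rewrite -leNgt; lra.
- apply/negP; rewrite -leNgt.
  have -> : x1 * - a2 + (y1 - 1) * a1 = a0 - a1 by rewrite -ea0; ring.
  have -> : x1 * - b2 + (y1 - 1) * b1 = b0 - b1 by rewrite -eb0; ring.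
  done.
- apply/negP; rewrite -leNgt.
  have -> : (x2 - 1) * - a2 + y2 * a1 = a2 - a3.
    by rewrite -[a3]opprK -ea3; ring.
  have -> : (x2 - 1) * - b2 + y2 * b1 = b2 - b3.
    by rewrite -[b3]opprK -eb3; ring.
  done.
- apply/negP; rewrite -leNgt.
  have -> : (x1 + x2) * - a2 + (y1 + y2) * a1 = - (a3 - a0).
    by rewrite -ea0 -[a3]opprK -ea3; ring.
  have -> : (x1 + x2) * - b2 + (y1 + y2) * b1 = - (b3 - b0).
    by rewrite -eb0 -[b3]opprK -eb3; ring.
  by rewrite !sqrrN.
Qed.

(* a ^+ 2 + a * b + b ^+ 2 is the squared norm of the vector of coordinates a, b
   on unit vectors at angle 60 degrees: two vectors of a sextant are not further
   apart than the longer one is from 0. *)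
Lemma sextant (a b c d : R) : 0 <= a -> 0 <= b -> 0 <= c -> 0 <= d ->
  2 * (a * c + b * d) + a * d + b * c < a ^+ 2 + a * b + b ^+ 2 ->
  2 * (a * c + b * d) + a * d + b * c < c ^+ 2 + c * d + d ^+ 2 -> False.
Proof.
move=> a0 b0 c0 d0 h1 h2.
have [ac|/ltW ca] := leP a c; have [bd|/ltW db] := leP b d.
- by move: h1; nra.
- have [h|/ltW h] := leP (b - d) (c - a); move: h1 h2; nra.
- have [h|/ltW h] := leP (d - b) (a - c); move: h1 h2; nra.
- by move: h2; nra.
Qed.

(** Each q_i makes an angle above 60 degrees with p, so the three lie in the two sextants from 60 to
    180 degrees. Two of them share one, against [sextant]. *)
Lemma no_four_in_half_plane p q1 q2 q3 s :
  sqnorm2 p < s -> sqnorm2 q1 < s -> sqnorm2 q2 < s -> sqnorm2 q3 < s ->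
  s <= sqnorm2 (p - q1) -> s <= sqnorm2 (p - q2) -> s <= sqnorm2 (p - q3) ->
  s <= sqnorm2 (q1 - q2) -> s <= sqnorm2 (q1 - q3) -> s <= sqnorm2 (q2 - q3) ->
  0 <= cross p q1 -> 0 <= cross p q2 -> 0 <= cross p q3 -> False.
Proof.
(* The tangent of 60 degrees. [X q] and [cross p q] are the coordinates of q along and across p,
   scaled by |p|. *)
pose k : R := Num.sqrt 3; have k0 : 0 < k by rewrite sqrtr_gt0; lra.
have kk : k ^+ 2 = 3 by rewrite sqr_sqrtr//; lra.
pose X q := p.1 * q.1 + p.2 * q.2.
have XY q : X q ^+ 2 + cross p q ^+ 2 = sqnorm2 p * sqnorm2 q.
  by rewrite /X /cross /sqnorm2; ring.
have dot q q' : sqnorm2 q < s -> sqnorm2 q' < s -> s <= sqnorm2 (q - q') ->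
    2 * (q.1 * q'.1 + q.2 * q'.2) < sqnorm2 q /\
    2 * (q.1 * q'.1 + q.2 * q'.2) < sqnorm2 q'.
  by rewrite /sqnorm2 /=; move=> *; split; lra.
have outside q : sqnorm2 p < s -> sqnorm2 q < s -> s <= sqnorm2 (p - q) ->
    0 <= cross p q -> k * X q < cross p q.
  move=> ps qs pq Y0; have [Xp Xq] := dot _ _ ps qs pq.
  rewrite ltNge; apply/negP => YX.
  have X0 : 0 <= X q by rewrite -(pmulr_rge0 _ k0); lra.
  have : cross p q ^+ 2 <= (k * X q) ^+ 2 by rewrite ler_pXn2r ?nnegrE//; lra.
  rewrite exprMn kk; have := XY q.
  (* By [XY] the right side is X^2 + Y^2, where Y is the cross product, so 3 X^2 < Y^2. *)
  have : 2 * X q * (2 * X q) < sqnorm2 p * sqnorm2 q.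
    by rewrite ltr_pM//; rewrite /X in X0 *; lra.
  by lra.
(* Serves both sextants: [a], [b] are the coordinates on the two sides of one, and the two
   identities turn norm and inner product into the forms of [sextant]. *)
have same q q' a b : sqnorm2 p < s -> sqnorm2 q < s -> sqnorm2 q' < s ->
    s <= sqnorm2 (q - q') -> sqnorm2 p != 0 ->
    (forall x y, 3 * (x ^+ 2 + y ^+ 2) =
      a x y ^+ 2 + a x y * b x y + b x y ^+ 2) ->
    (forall x y x' y', 6 * (x * x' + y * y') =
      2 * (a x y * a x' y' + b x y * b x' y') +
      a x y * b x' y' + b x y * a x' y') ->
    0 <= a (X q) (cross p q) -> 0 <= b (X q) (cross p q) ->
    0 <= a (X q') (cross p q') -> 0 <= b (X q') (cross p q') -> False.
  move=> ps qs q's qq' pn0 sq pol a0 b0 a'0 b'0.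
  have P0 : 0 < sqnorm2 p by rewrite lt_neqAle eq_sym pn0 sqnorm2_ge0.
  have [hq hq'] := dot _ _ qs q's qq'.
  have XYe : X q * X q' + cross p q * cross p q' =
      sqnorm2 p * (q.1 * q'.1 + q.2 * q'.2).
    by rewrite /X /cross /sqnorm2; ring.
  apply: (sextant a0 b0 a'0 b'0); rewrite -pol -sq XYe XY.
  - by rewrite -(ltr_pM2l P0) in hq; lra.
  - by rewrite -(ltr_pM2l P0) in hq'; lra.
move=> ps q1s q2s q3s p1 p2 p3 d12 d13 d23 Y1 Y2 Y3.
have pn0 : sqnorm2 p != 0.
  apply/eqP => p0; move: p1 p0 q1s; case: (p) (q1) => [a b] [c d].
  rewrite /sqnorm2 /= => p1 p0.
  have /eqP : a ^+ 2 + b ^+ 2 = 0 by [].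
  rewrite paddr_eq0 ?sqr_ge0// !sqrf_eq0 => /andP[/eqP a0 /eqP b0].
  by move: p1; rewrite a0 b0 => p1; lra.
have o1 := outside _ ps q1s p1 Y1.
have o2 := outside _ ps q2s p2 Y2.
have o3 := outside _ ps q3s p3 Y3.
(* Coordinates, up to scaling, on the sides of the sextants at angles 60-120
   and 120-180 degrees from p; the sextant next to p contains no q_i. *)
pose aB x y : R := y + k * x; pose bB x y : R := y - k * x.
pose aC (x y : R) : R := 2 * y; pose bC x y : R := - y - k * x.
have sameB q q' qs q's qq' := same q q' aB bB ps qs q's qq' pn0.
have sameC q q' qs q's qq' := same q q' aC bC ps qs q's qq' pn0.
have norm_sextant x y : 3 * (x ^+ 2 + y ^+ 2) = 3 * y ^+ 2 + k ^+ 2 * x ^+ 2.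
  by rewrite kk; ring.
have dot_sextant x y x' y' :
    6 * (x * x' + y * y') = 6 * (y * y') + 2 * k ^+ 2 * (x * x').
  by rewrite kk; ring.
have {}sameB : forall q q', sqnorm2 q < s -> sqnorm2 q' < s ->
    s <= sqnorm2 (q - q') -> k * X q < cross p q -> k * X q' < cross p q' ->
    0 <= cross p q + k * X q -> 0 <= cross p q' + k * X q' -> False.
  move=> q q' qs q's qq' o o' B B'.
  apply: (sameB _ _ qs q's qq') => //; rewrite /aB /bB.
  - by move=> x y; rewrite norm_sextant; ring.
  - by move=> x y x' y'; rewrite dot_sextant; ring.
  - lra.
  - lra.
have {}sameC : forall q q', sqnorm2 q < s -> sqnorm2 q' < s ->
    s <= sqnorm2 (q - q') -> 0 <= cross p q -> 0 <= cross p q' ->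
    cross p q + k * X q <= 0 -> cross p q' + k * X q' <= 0 -> False.
  move=> q q' qs q's qq' o o' B B'.
  apply: (sameC _ _ qs q's qq'); rewrite /aC /bC.
  - by move=> x y; rewrite norm_sextant; ring.
  - by move=> x y x' y'; rewrite dot_sextant; ring.
  - lra.
  - lra.
  - lra.
  - lra.
have [B1|/ltW C1] := leP 0 (cross p q1 + k * X q1);
have [B2|/ltW C2] := leP 0 (cross p q2 + k * X q2);
have [B3|/ltW C3] := leP 0 (cross p q3 + k * X q3).
- exact: (sameB q1 q2).
- exact: (sameB q1 q2).
- exact: (sameB q1 q3).
- exact: (sameC q2 q3).
- exact: (sameB q2 q3).
- exact: (sameC q1 q3).
- exact: (sameC q1 q2).
- exact: (sameC q1 q2).
Qed.

(** Mirror image under reflection in the first axis. *)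
Lemma no_four_in_half_planeN p q1 q2 q3 s :
  sqnorm2 p < s -> sqnorm2 q1 < s -> sqnorm2 q2 < s -> sqnorm2 q3 < s ->
  s <= sqnorm2 (p - q1) -> s <= sqnorm2 (p - q2) -> s <= sqnorm2 (p - q3) ->
  s <= sqnorm2 (q1 - q2) -> s <= sqnorm2 (q1 - q3) -> s <= sqnorm2 (q2 - q3) ->
  cross p q1 <= 0 -> cross p q2 <= 0 -> cross p q3 <= 0 -> False.
Proof.
pose f p : R * R := (p.1, - p.2).
have sqf q : sqnorm2 (f q) = sqnorm2 q by rewrite /sqnorm2 sqrrN.
have sqfB q q' : sqnorm2 (f q - f q') = sqnorm2 (q - q').
  by rewrite /sqnorm2 /= -[in RHS]sqrrN opprB opprK addrC; lra.
have cf q q' : cross (f q) (f q') = - cross q q' by rewrite /cross /=; ring.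
move=> ? ? ? ? ? ? ? ? ? ? ? ? ?.
by apply: (@no_four_in_half_plane (f p) (f q1) (f q2) (f q3) s);
  rewrite ?sqf ?sqfB ?cf ?oppr_ge0.
Qed.

(** Reorders a [uniq] list, using inequalities of the context in either orientation. *)
Ltac distinct := by rewrite /= !inE !negb_or;
  repeat (apply/andP; split); do ?done; rewrite eq_sym.

(** * Five separated points with far alternating sums do not exist *)

Section FivePoints.
Context {T : eqType} (w : T -> R * R) (q : T -> int) (s : R) (Q : int).
Hypothesis ws : forall i, sqnorm2 (w i) < s.
Hypothesis wB : forall i j, i != j -> s <= sqnorm2 (w i - w j).
Hypothesis qB : forall i j, i != j -> q i != q j /\ (q i - q j < Q)%R.
Hypothesis q_alt : forall i j k l, sqnorm2 (w i - w j + w k - w l) < s ->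
  let e := q i - q j + q k - q l in [\/ e = 0, Q <= e | e <= - Q].

Let c i j := cross (w i) (w j).

Let cN i j : c j i = - c i j. Proof. by rewrite /c /cross; ring. Qed.

Lemma no_three_left i a b d :
  uniq [:: i; a; b; d] -> [&& 0 <= c i a, 0 <= c i b & 0 <= c i d] -> False.
Proof.
move=> /= /and4P[]; rewrite !inE !negb_or => /and3P[ia ib id] /andP[ab ad] bd _.
by move=> /and3P[]; apply: no_four_in_half_plane; first [exact: ws|exact: wB].
Qed.

Lemma no_three_right i a b d :
  uniq [:: i; a; b; d] -> [&& c i a <= 0, c i b <= 0 & c i d <= 0] -> False.
Proof.
move=> /= /and4P[]; rewrite !inE !negb_or => /and3P[ia ib id] /andP[ab ad] bd _.
by move=> /and3P[]; apply: no_four_in_half_planeN; first [exact: ws|exact: wB].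
Qed.

(** The signs say that each vertex has the next two on its left. [alternating_sum_small] then
    applies to any four consecutive vertices, and [no_odd_cycle] to the five sums of q's. *)
Lemma no_pentagon (v0 v1 v2 v3 v4 : T) : uniq [:: v0; v1; v2; v3; v4] ->
  0 < c v0 v1 -> 0 < c v1 v2 -> 0 < c v2 v3 -> 0 < c v3 v4 -> 0 < c v4 v0 ->
  0 < c v0 v2 -> 0 < c v1 v3 -> 0 < c v2 v4 -> 0 < c v3 v0 -> 0 < c v4 v1 ->
  False.
Proof.
rewrite /c => /= /and5P[]; rewrite !inE !negb_or.
move=> /and4P[n01 n02 n03 n04] /and3P[n12 n13 n14] /andP[n23 n24] n34 _.
move=> c01 c12 c23 c34 c40 c02 c13 c24 c30 c41.
have alt i j k l : i != j -> j != k -> k != l -> l != i ->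
    0 < cross (w i) (w j) -> 0 < cross (w i) (w k) -> 0 < cross (w j) (w k) ->
    0 < cross (w j) (w l) -> 0 < cross (w k) (w l) -> 0 < cross (w l) (w i) ->
    let e := q i - q j + q k - q l in [\/ e = 0, Q <= e | e <= - Q].
  by move=> *; apply/q_alt/alternating_sum_small => //; exact: wB.
have sym (i j : T) : i != j -> j != i by rewrite eq_sym.
have a0 := alt v0 v1 v2 v3 n01 n12 n23 (sym _ _ n03) c01 c02 c12 c13 c23 c30.
have a1 := alt v1 v2 v3 v4 n12 n23 n34 (sym _ _ n14) c12 c13 c23 c24 c34 c41.
have a2 := alt v2 v3 v4 v0 n23 n34 (sym _ _ n04) n02 c23 c24 c34 c30 c40 c02.
have a3 := alt v3 v4 v0 v1 n34 (sym _ _ n04) n01 n13 c34 c30 c40 c41 c01 c13.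
have a4 := alt v4 v0 v1 v2 (sym _ _ n04) n01 n12 n24 c40 c41 c01 c02 c12 c24.
(* Consecutive alternating sums telescope to a difference of two q's. *)
have sumE (x y z t u : int) : x - y + z - t + (y - z + t - u) = x - u by ring.
have near i j : i != j -> q i - q j != 0 /\ `|q i - q j| < Q.
  move=> ij; have [qij lt] := qB ij; split; first by rewrite subr_eq0.
  by have [_ lt'] := qB (sym _ _ ij); rewrite ltr_norml ltrNl opprB lt lt'.
by apply: (no_odd_cycle a0 a1 a2 a3 a4); rewrite sumE; apply: near;
  rewrite // eq_sym.
Qed.

(** Once [a] precedes [b] and [d] precedes [e], the cyclic order is i, a, b, d, e: any other sign
    would put three points in a closed half plane bounded by the line through a fourth. *)
Lemma five_points_split (i a b d e : T) : uniq [:: i; a; b; d; e] ->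
  0 < c i a -> 0 < c i b -> c i d <= 0 -> c i e <= 0 -> False.
Proof.
move=> /= /and5P[]; rewrite !inE !negb_or.
move=> /and4P[nia nib nid nie] /and3P[nab nad nae] /andP[nbd nbe] nde _.
wlog ab : a b nia nib nab nad nae nbd nbe / 0 <= c a b => [hw|].
  have [|ba] := leP 0 (c a b); first exact: hw.
  have ba' : 0 <= c b a by rewrite (cN a b) oppr_ge0 ltW.
  by move=> ia ib; apply: (hw b a) => //; rewrite eq_sym.
wlog de : d e nid nie nad nae nbd nbe nde / 0 <= c d e => [hw|].
  have [|ed] := leP 0 (c d e); first exact: hw.
  have ed' : 0 <= c e d by rewrite (cN d e) oppr_ge0 ltW.
  by move=> ia ib id ie; apply: (hw e d) => //; rewrite eq_sym.
move=> ia ib id ie.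
have right x y z t :
    uniq [:: x; y; z; t] -> 0 <= c y x -> 0 <= c z x -> 0 < c x t.
  move=> u xy xz; rewrite ltNge; apply/negP => xt; apply: (no_three_right u).
  by rewrite xt (cN y x) (cN z x) !oppr_le0 xy xz.
have ltc x y : c x y != 0 -> c x y <= 0 -> 0 < c y x.
  by rewrite lt_def (cN x y) oppr_eq0 oppr_ge0 => -> ->.
have di : 0 < c d i.
  apply: ltc => //; apply/eqP => id0.
  by apply: (@no_three_left i a b d); [distinct|];
    rewrite id0 lexx (ltW ia) (ltW ib).
have ei : 0 < c e i.
  apply: ltc => //; apply/eqP => ie0.
  by apply: (@no_three_left i a b e); [distinct|];
    rewrite ie0 lexx (ltW ia) (ltW ib).
have bd : 0 < c b d by apply: (right b i a d) => //; [distinct|exact: ltW].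
have be : 0 < c b e by apply: (right b i a e) => //; [distinct|exact: ltW].
have ea : 0 < c e a by apply: (right e d b a) => //; [distinct|exact: ltW].
have ad : 0 < c a d by apply: (right a i e d); [distinct|exact: ltW..].
have {}ab : 0 < c a b by apply: (right a i e b); [distinct|exact: ltW..].
have {}de : 0 < c d e by apply: (right d a b e); [distinct|exact: ltW..].
by apply: (@no_pentagon i a b d e) => //; distinct.
Qed.

(** Exactly two of the other points lie strictly to the left of [i], as three on one side are
    impossible; this leaves [five_points_split]. *)
Lemma no_five_points (i a b d e : T) : uniq [:: i; a; b; d; e] -> False.
Proof.
move=> /= /and5P[]; rewrite !inE !negb_or.
move=> /and4P[nia nib nid nie] /and3P[nab nad nae] /andP[nbd nbe] nde _.
have left x y z : uniq [:: i; x; y; z] ->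
    0 < c i x -> 0 < c i y -> 0 < c i z -> False.
  move=> u x0 y0 z0; apply: (no_three_left u).
  by rewrite (ltW x0) (ltW y0) (ltW z0).
have right x y z : uniq [:: i; x; y; z] ->
    c i x <= 0 -> c i y <= 0 -> c i z <= 0 -> False.
  by move=> u *; apply: (no_three_right u); apply/and3P; split.
have [pa|na] := ltP 0 (c i a); have [pb|nb] := ltP 0 (c i b);
  have [pd|nd] := ltP 0 (c i d); have [pe|ne] := ltP 0 (c i e).
- by apply: (left a b d) => //; distinct.
- by apply: (left a b d) => //; distinct.
- by apply: (left a b e) => //; distinct.
- by apply: (@five_points_split i a b d e) => //; distinct.
- by apply: (left a d e) => //; distinct.
- by apply: (@five_points_split i a d b e) => //; distinct.
- by apply: (@five_points_split i a e b d) => //; distinct.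
- by apply: (right b d e) => //; distinct.
- by apply: (left b d e) => //; distinct.
- by apply: (@five_points_split i b d a e) => //; distinct.
- by apply: (@five_points_split i b e a d) => //; distinct.
- by apply: (right a d e) => //; distinct.
- by apply: (@five_points_split i d e a b) => //; distinct.
- by apply: (right a b e) => //; distinct.
- by apply: (right a b d) => //; distinct.
- by apply: (right a b d) => //; distinct.
Qed.

End FivePoints.

End Plane.

(** * The one-dimensional case *)

(** Separated points have opposite signs, which three numbers cannot have pairwise. *)
Lemma no_three_on_line {R : realFieldType} (x y z s : R) :
  x ^+ 2 < s -> y ^+ 2 < s -> z ^+ 2 < s -> s <= (x - y) ^+ 2 ->
  s <= (x - z) ^+ 2 -> s <= (y - z) ^+ 2 -> False.
Proof.
have opposite (u v : R) :
    u ^+ 2 < s -> v ^+ 2 < s -> s <= (u - v) ^+ 2 -> u * v < 0.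
  move=> us vs uv; rewrite ltNge; apply/negP => uv0.
  have [h|h] := leP (u ^+ 2) (u * v); first by lra.
  have h1 : v ^+ 2 <= u * v -> False by lra.
  have v2 : 0 <= v ^+ 2 by exact: sqr_ge0.
  have u2 : 0 <= u ^+ 2 by exact: sqr_ge0.
  nra.
move=> xs ys zs /(opposite _ _ xs ys) xy.
move=> /(opposite _ _ xs zs) xz /(opposite _ _ ys zs) yz.
have h : 0 < (x * y) * (x * z) by rewrite nmulr_rgt0.
have h2 : 0 <= x ^+ 2 by exact: sqr_ge0.
nra.
Qed.

(** * Inner products and orthonormal coordinates *)

Section InnerProduct.
Context {R : realType} {V : vectType R} (ip : {dot V for @idfun R}).

Lemma ipC u v : ip u v = ip v u.
Proof. by rewrite (hermitian_subproof (s := ip)) expr0 mul1r. Qed.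

Lemma ip_ge0 v : 0 <= ip v v.
Proof.
have [->|v0] := eqVneq v 0; first by rewrite linear0l.
exact/ltW/neq0_dnorm_gt0.
Qed.

Lemma ipDl u v w : ip (u + v) w = ip u w + ip v w.
Proof. exact: linearDl. Qed.

Lemma ipBl u v w : ip (u - v) w = ip u w - ip v w.
Proof. exact: linearBl. Qed.

Lemma ipZl c v w : ip (c *: v) w = c * ip v w.
Proof. by rewrite linearZl_LR. Qed.

Lemma ipnorm_ltP v (r : R) : 0 < r -> (ipnorm ip v < r) = (ip v v < r ^+ 2).
Proof.
move=> r0; rewrite /ipnorm -[in LHS](ger0_norm (ltW r0)) -sqrtr_sqr.
by rewrite ltr_sqrt// exprn_gt0.
Qed.

(* An orthonormal basis of E, padded with zeros. *)
Lemma parseval2 (E : {vspace V}) : (\dim E <= 2)%N ->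
  exists f1 f2, [/\ f1 \in E, f2 \in E, (\dim E <= 1)%N -> f2 = 0 &
    forall e, e \in E -> e = ip e f1 *: f1 + ip e f2 *: f2].
Proof.
have dim1 (F : {vspace V}) : (\dim F <= 1)%N ->
    exists2 f, f \in F & forall e, e \in F -> e = ip e f *: f.
  rewrite leq_eqVlt => /orP[F1|]; last first.
    rewrite ltnS leqn0 dimv_eq0 => /eqP->; exists 0; first exact: mem0v.
    by move=> e; rewrite memv0 scaler0 => /eqP.
  pose b := vpick F.
  have b0 : b != 0 by rewrite vpick0 -dimv_eq0 (eqP F1).
  have bF : b \in F := memv_pick F.
  have eF : F = <[b]>%VS.
    apply/esym/eqP; rewrite eqEdim -memvE bF dim_vline b0 (eqP F1).
    by [].
  exists ((ipnorm ip b)^-1 *: b); first exact: memvZ.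
  have N0 : ipnorm ip b != 0 by rewrite gt_eqF// sqrtr_gt0 neq0_dnorm_gt0.
  move=> e; rewrite eF => /vlineP[c ->].
  rewrite ipC !ipZl ipC ipZl !scalerA; congr (_ *: _).
  have -> : ip b b = ipnorm ip b ^+ 2 by rewrite sqr_sqrtr// ip_ge0.
  by field; exact: N0.
move=> E2; have [E1|E1] := leqP (\dim E) 1.
  have [f fE fP] := dim1 _ E1; exists f, 0; split=> //; first exact: mem0v.
  by move=> e /fP {1}->; rewrite scaler0 addr0.
pose b := vpick E.
have b0 : b != 0 by rewrite vpick0 -dimv_eq0 -lt0n; apply: leq_trans E1.
have bE : b \in E := memv_pick E.
pose f1 := (ipnorm ip b)^-1 *: b.
have N0 : ipnorm ip b != 0 by rewrite gt_eqF// sqrtr_gt0 neq0_dnorm_gt0.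
have f1E : f1 \in E by exact: memvZ.
have f11 : ip f1 f1 = 1.
  rewrite /f1 ipZl ipC ipZl.
  have -> : ip b b = ipnorm ip b ^+ 2 by rewrite sqr_sqrtr// ip_ge0.
  by field; exact: N0.
(* The complement of f1 in E loses a dimension because f1 is not orthogonal to itself. *)
pose F := (E :&: orthov ip <[f1]>)%VS.
have dimF : (\dim F <= 1)%N.
  rewrite -eq_dim_orthov1; first by rewrite -ltnS prednK// (leq_trans _ E1).
  apply/negP => /mem_orthovP/(_ _ f1E) f10.
  by move/eqP: f11; rewrite (f10 : ip f1 f1 = 0) eq_sym oner_eq0.
have [f2 f2F f2P] := dim1 _ dimF.
have [f2E f2f1] : f2 \in E /\ ip f2 f1 = 0.
  by move/memv_capP: f2F => [? /mem_orthovP ->//]; rewrite memv_line.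
exists f1, f2; split=> // e eE.
have eF : e - ip e f1 *: f1 \in F.
  apply/memv_capP; split; first by rewrite memvB// memvZ.
  rewrite mem_orthov1; apply/eqP.
  by have : ip (e - ip e f1 *: f1) f1 = 0 by rewrite ipBl ipZl f11 mulr1 subrr.
have := f2P _ eF; rewrite ipBl ipZl [ip f1 f2]ipC f2f1 mulr0 subr0 => <-.
by rewrite addrC subrK.
Qed.

End InnerProduct.

(** * Best returns, their lifts and the effective span *)

Section Returns.
Local Open Scope quotient_scope.
Context {R : realType} {V : vectType R} {U : zmodType}.
Variables (ip : {dot V for @idfun R}) (dU : U -> U -> R).
Hypothesis dU_ultra : invariant_ultrametric dU.
Variable L : zmodClosed (V * U)%type.
Implicit Types (a x y : V * U) (alpha : {quot L}).

(** Here the ultrametric inequality enters: the bound does not grow with the number of summands. *)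
Lemma umet0D u w r : dU u 0 < r -> dU w 0 < r -> dU (u + w) 0 < r.
Proof.
move=> ur wr; apply: le_lt_trans (umet_ultra dU_ultra _ w _) _.
by rewrite gt_max wr andbT -[X in dU _ X]add0r umet_transl.
Qed.

Lemma umet0N u : dU (- u) 0 = dU u 0.
Proof.
by rewrite -(umet_transl dU_ultra u) addNr add0r umet_sym.
Qed.

Lemma umet0B u w r : dU u 0 < r -> dU w 0 < r -> dU (u - w) 0 < r.
Proof. by move=> ur wr; apply: umet0D => //; rewrite umet0N. Qed.

Lemma pnorm_ge0 x : 0 <= pnorm ip dU x.
Proof. by rewrite le_max sqrtr_ge0. Qed.

Lemma return_distE a k : return_dist ip dU (\pi_{quot L} a) k =
  inf [set r | exists2 l, l \in L & r = pnorm ip dU (a *+ k - l)]%classic.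
Proof. by rewrite /return_dist /qdist subr0 -raddfMn qnormE. Qed.

Let dist_has_inf a k :
  has_inf [set r | exists2 l, l \in L & r = pnorm ip dU (a *+ k - l)]%classic.
Proof.
split.
  by exists (pnorm ip dU (a *+ k - 0)); exists 0 => //; exact: rpred0.
by exists 0 => _ [l _ ->]; exact: pnorm_ge0.
Qed.

Lemma return_dist_le a k l : l \in L ->
  return_dist ip dU (\pi_{quot L} a) k <= pnorm ip dU (a *+ k - l).
Proof.
move=> lL; rewrite return_distE; apply: ge_inf; last by exists l.
by case: (dist_has_inf a k).
Qed.

(** The infimum need not be attained, so lifts come from strict bounds; the return of q_n is such a
    bound for all later denominators. *)
Lemma return_dist_lt a k r : return_dist ip dU (\pi_{quot L} a) k < r ->
  exists2 l, l \in L & pnorm ip dU (a *+ k - l) < r.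
Proof.
rewrite return_distE => /inf_lt[].
  by case: (dist_has_inf a k).
by move=> _ [l lL ->] lr; exists l.
Qed.

Lemma return_dist_ge a k r :
  (forall l, l \in L -> r <= pnorm ip dU (a *+ k - l)) ->
  r <= return_dist ip dU (\pi_{quot L} a) k.
Proof.
move=> rl; rewrite return_distE; apply: lb_le_inf.
  by case: (dist_has_inf a k).
by move=> _ [l lL ->]; exact: rl.
Qed.

Lemma best_denom_ge alpha n q : best_denom ip dU alpha n q ->
  forall p, (0 < p)%N -> (p <= q)%N ->
    return_dist ip dU alpha q <= return_dist ip dU alpha p.
Proof.
elim=> [|{}n {}q q' _ IH qq' lt min] p p0 pq.
  by have -> : p = 1%N by lia.
have [->//|pq'] := eqVneq p q'.
have [pq''|qp] := leqP p q.
  by apply: ltW; apply: lt_le_trans lt (IH _ _ _).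
apply/ltW/(lt_le_trans lt); rewrite leNgt; apply/negP => /(min _ qp); lia.
Qed.

Lemma best_denom_uniq alpha n q q' :
  best_denom ip dU alpha n q -> best_denom ip dU alpha n q' -> q = q'.
Proof.
move=> h; elim: h q' => [|{}n {}q q1 hq IH qq1 lt1 min1] q' h'.
  inversion h' => //.
  by match goal with H : best_denom _ _ _ 0 _ |- _ => inversion H end.
inversion h' as [|n' q2 q2' hq2 qq2 lt2 min2]; subst.
  by inversion hq.
have e := IH _ hq2; subst q2.
by apply/eqP; rewrite eqn_leq min1// min2.
Qed.

(** Turns the inductive relation into a sequence; only the values at 1, ..., n carry information. *)
Lemma best_denom_seq alpha n q : best_denom ip dU alpha n q ->
  exists s : nat -> nat,
    [/\ forall i, (0 < i <= n)%N -> best_denom ip dU alpha i (s i),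
        forall i j, (0 < i)%N -> (i < j <= n)%N -> (s i < s j)%N,
        forall i j, (0 < i)%N -> (i < j <= n)%N ->
          return_dist ip dU alpha (s j) < return_dist ip dU alpha (s i) &
        s n = q].
Proof.
elim=> [|{}n {}q q' hq [s [sd slt rlt sn]] qq' lt min].
  exists (fun=> 1%N); split=> // [i i1|i j i0 ij|i j i0 ij]; try lia.
  have -> : i = 1%N by lia.
  exact: best_denom1.
have hq' : best_denom ip dU alpha n.+1 q' by apply: best_denomS hq qq' lt min.
exists (fun i => if i == n.+1 then q' else s i).
split=> [i i0|i j i0 ij|i j i0 ij|].
- by case: eqP => [->//|/eqP ni]; apply: sd; lia.
- rewrite [i == _]ltn_eqF; last by lia.
  case: eqP => [_|/eqP nj]; last by apply: slt; lia.
  apply: leq_ltn_trans qq'; rewrite -sn; have [->//|ne] := eqVneq i n.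
  by apply/ltnW/slt; lia.
- rewrite [i == _]ltn_eqF; last by lia.
  case: eqP => [_|/eqP nj]; last by apply: rlt; lia.
  apply: lt_le_trans lt _; rewrite -sn; have [->//|ne] := eqVneq i n.
  by apply/ltW/rlt; lia.
- by rewrite eqxx.
Qed.

Lemma perp_proj_eff a : a \in L -> perp_proj ip L a.1 \in eff_span ip L.
Proof.
move=> aL; apply/mem_set_span; exists [:: perp_proj ip L a.1].
  by move=> x; rewrite inE => /eqP ->; exists a.
by rewrite memv_span1.
Qed.

(** The span is generated by projections into the complement of the lineality space. *)
Lemma eff_span_orth e w :
  e \in eff_span ip L -> w \in lineality L -> ip e w = 0.
Proof.
have eff_sub : (eff_span ip L <= orthov ip (lineality L))%VS.
  apply/subvP => x /mem_set_span[t tL]; apply/subvP/span_subvP => y /tL[b _ ->].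
  by have [] := perp_projP ip L b.1.
by move=> /(subvP eff_sub)/mem_orthovP eP wW; exact: eP.
Qed.

Lemma ip_perp_proj v f :
  f \in eff_span ip L -> ip (perp_proj ip L v) f = ip v f.
Proof.
move=> fE; have [_ vW] := perp_projP ip L v.
apply/eqP; rewrite eq_sym -subr_eq0 -ipBl ipC; apply/eqP.
exact: eff_span_orth.
Qed.

Lemma perp_proj_le v : ip (perp_proj ip L v) (perp_proj ip L v) <= ip v v.
Proof.
have [pW vW] := perp_projP ip L v.
have := mem_orthovP pW _ vW; move: (perp_proj ip L v) => p pv.
have {}pv : ip p v = ip p p.
  by apply/eqP; rewrite -subr_eq0 -linearBr; apply/eqP.
rewrite -subr_ge0; have := ip_ge0 ip (v - p).
by rewrite ipBl [ip v _]ipC [ip p (v - p)]ipC !ipBl [ip v p]ipC pv subrr subr0.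
Qed.

(* x is a lift of k alpha, which may be moved along the lineality space. *)
Lemma return_dist_perp a x k : a *+ k - x \in L ->
  return_dist ip dU (\pi_{quot L} a) k <=
    Num.max (ipnorm ip (perp_proj ip L x.1)) (dU x.2 0).
Proof.
move=> kL; pose y : V * U := (perp_proj ip L x.1, x.2).
have xyL : x - y \in L.
  have [_ /mem_lineality/(_ 1)] := perp_projP ip L x.1; rewrite scale1r.
  by congr (_ \in L); congr pair; rewrite /= subrr.
rewrite -/(pnorm ip dU y).
have -> : y = a *+ k - (a *+ k - y) by rewrite subKr.
by apply: return_dist_le; rewrite -(subrK x (a *+ k)) -addrA rpredD.
Qed.

(* With eta the squared norm of the component of a orthogonal to E and to the
   lineality space: that component is unchanged by L. *)
Lemma eff_coordinates a : (eff_dim ip L <= 2)%N ->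
  exists f1 f2 (eta : R), [/\ 0 <= eta, (eff_dim ip L <= 1)%N -> f2 = 0 &
    forall (k : int) x, a *~ k - x \in L ->
      ip (perp_proj ip L x.1) (perp_proj ip L x.1) =
        k%:~R ^+ 2 * eta + sqnorm2 (ip x.1 f1, ip x.1 f2)].
Proof.
move=> /(parseval2 ip)[f1 [f2 [f1E f2E f20 expand]]].
pose p := perp_proj ip L a.1.
pose eta := ip p p - (ip p f1 ^+ 2 + ip p f2 ^+ 2).
have ip_exp u e : e \in eff_span ip L ->
    ip u e = ip e f1 * ip u f1 + ip e f2 * ip u f2.
  move=> /expand eE; rewrite [in LHS]ipC [in LHS]eE ipDl !ipZl.
  by rewrite [ip f1 u]ipC [ip f2 u]ipC.
have ip_lin u v (c : R) : ip (c *: u - v) (c *: u - v) =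
    c ^+ 2 * ip u u - 2 * c * ip u v + ip v v.
  rewrite ipBl ipZl [ip u (_ - _)]ipC [ip v (_ - _)]ipC !ipBl !ipZl [ip v u]ipC.
  by ring.
have key (c : R) e : e \in eff_span ip L -> ip (c *: p - e) (c *: p - e) =
    c ^+ 2 * eta + sqnorm2 (ip (c *: p - e) f1, ip (c *: p - e) f2).
  move=> eE; rewrite ip_lin (ip_exp p e eE) (ip_exp e e eE).
  rewrite /sqnorm2 /= !ipBl !ipZl.
  by rewrite /eta; ring.
exists f1, f2, eta; split=> // [|k x kL].
  (* The orthogonal projection of p on the span; eta is the squared norm of p - e, hence
     nonnegative. *)
  pose e := ip p f1 *: f1 + ip p f2 *: f2.
  have eE : e \in eff_span ip L by rewrite memvD// memvZ.
  have ef f : f \in eff_span ip L -> ip e f = ip p f.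
    by move=> fE; rewrite /e ipDl !ipZl (ip_exp p f fE) ![ip f _]ipC; ring.
  have := ip_ge0 ip (1 *: p - e); rewrite key// expr1n mul1r /sqnorm2 /=.
  by rewrite !ipBl !ipZl !mul1r !ef// !subrr expr0n /= !addr0.
set l := a *~ k - x in kL.
have xE : x.1 = k%:~R *: a.1 - l.1.
  by rewrite /l /= opprB addrC scaler_int -[in RHS]/((a *~ k).1) raddfMz subrK.
have pE : perp_proj ip L x.1 = k%:~R *: p - perp_proj ip L l.1.
  by rewrite {1}xE linearB linearZ.
have := key k%:~R _ (perp_proj_eff kL); rewrite -pE => ->.
by rewrite !ip_perp_proj.
Qed.

Lemma best_denom_lt alpha n q0 q1 p :
  best_denom ip dU alpha n q0 -> best_denom ip dU alpha n.+1 q1 ->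
  (0 < n)%N -> (0 < p < q1)%N ->
  return_dist ip dU alpha q0 <= return_dist ip dU alpha p.
Proof.
move=> h0 h1 n0 /andP[p0 pq1].
inversion h1 as [|n' q q' h qq lt min]; subst; first by [].
have e := best_denom_uniq h0 h; subst q.
have [pq|qp] := leqP p q0; first exact: best_denom_ge h0 _ p0 pq.
by rewrite leNgt; apply/negP => /(min _ qp); lia.
Qed.

(** Passage to plane geometry: [w] holds coordinates in the effective span of lifts of the K
    denominators after the n-th, [k] those denominators, and [r] a squared radius. *)
Lemma separated_lifts alpha n K q0 q1 q : (eff_dim ip L <= 2)%N ->
  (0 < n)%N -> best_denom ip dU alpha n q0 -> best_denom ip dU alpha n.+1 q1 ->
  best_denom ip dU alpha (n + K) q -> (1 < K)%N -> (q <= q0 + q1)%N ->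
  exists (r : R) (w : 'I_K -> R * R) (k : 'I_K -> int) (Q : int),
    [/\ forall i, sqnorm2 (w i) < r,
        forall i j, i != j -> r <= sqnorm2 (w i - w j),
        forall i j, i != j -> k i != k j /\ k i - k j < Q,
        forall i j i' j', sqnorm2 (w i - w j + w i' - w j') < r ->
          let e := k i - k j + k i' - k j' in [\/ e = 0, Q <= e | e <= - Q] &
        (eff_dim ip L <= 1)%N -> forall i, (w i).2 = 0].
Proof.
move=> m2 n0 h0 h1 h K1 qle; have [s [sd slt rlt sn]] := best_denom_seq h.
have s0 : s n = q0 by apply: best_denom_uniq h0; apply: sd; lia.
have s1 : s n.+1 = q1 by apply: best_denom_uniq h1; apply: sd; lia.
have q01 : (q0 < q1)%N by rewrite -s0 -s1; apply: slt; lia.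
pose a := repr alpha; have alphaE : alpha = \pi_{quot L} a by rewrite reprK.
set r := return_dist ip dU alpha q0.
have r_gt0 : 0 < r.
  apply: le_lt_trans (_ : return_dist ip dU alpha q1 < r).
    by rewrite alphaE; apply: return_dist_ge => l _; exact: pnorm_ge0.
  by rewrite /r -s0 -s1; apply: rlt; lia.
have [f1 [f2 [eta [eta0 f20 coordE]]]] := eff_coordinates a m2.
pose phi x := (ip x.1 f1, ip x.1 f2) : R * R.
have phiB x y : phi (x - y) = phi x - phi y by rewrite /phi /= !ipBl.
have phiD x y : phi (x + y) = phi x + phi y by rewrite /phi /= !ipDl.
(* A lift of k alpha spends k^2 eta of its squared norm outside the span. The threshold is k = q1:
   below it less is spent, and the lifted denominators spend at least as much. *)
pose t := r ^+ 2 - q1%:R ^+ 2 * eta.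
have short_nat (k : nat) x : a *~ k - x \in L -> dU x.2 0 < r ->
    sqnorm2 (phi x) < t -> (0 < k)%N -> (q1 <= k)%N.
  move=> kL ur pt k0; rewrite leqNgt; apply/negP => kq1.
  have : r <= return_dist ip dU alpha k by apply: best_denom_lt h0 h1 n0 _; lia.
  apply/negP; rewrite -ltNge alphaE; apply: le_lt_trans (return_dist_perp kL) _.
  rewrite gt_max ur andbT ipnorm_ltP// (coordE _ _ kL).
  have : k%:R ^+ 2 * eta <= q1%:R ^+ 2 * eta.
    by rewrite ler_wpM2r// ler_pXn2r ?nnegrE ?ler0n// ler_nat ltnW.
  by move: pt; rewrite /t -/(phi x) -pmulrn; move: (sqnorm2 (phi x)) => z; lra.
have short (k : int) x : a *~ k - x \in L -> dU x.2 0 < r ->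
    sqnorm2 (phi x) < t -> [\/ k = 0, q1%:Z <= k | k <= - q1%:Z].
  case: k => k kL ur pt.
    case: k kL => [|k] kL; first by constructor 1.
    by constructor 2; have := short_nat _ _ kL ur pt isT; lia.
  constructor 3; suff : (q1 <= k.+1)%N by lia.
  apply: (short_nat _ (- x)) => //.
    by rewrite -rpredN opprB addrC -mulrNz.
    by rewrite umet0N.
  by rewrite -[- x]sub0r phiB /sqnorm2 /phi /= !linear0l !sub0r !sqrrN.
have lifts (i : 'I_K) : exists x, [/\ a *~ (s (n.+1 + i)%N)%:Z - x \in L,
    dU x.2 0 < r & sqnorm2 (phi x) < t].
  have iK := ltn_ord i; set k := s (n.+1 + i)%N.
  have kq1 : (q1 <= k)%N.
    have [i0|i0] := posnP i; first by rewrite /k i0 addn0 s1.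
    by rewrite -s1; apply/ltnW/slt; lia.
  have : return_dist ip dU alpha k < r by rewrite /r -s0; apply: rlt; lia.
  rewrite alphaE => /return_dist_lt[l lL]; set x := a *+ k - l => xr.
  have kL : a *~ k%:Z - x \in L by rewrite /x subKr.
  move: xr; rewrite gt_max => /andP[xr ur]; exists x; split=> //.
  move: xr; rewrite ipnorm_ltP// => xr.
  have := le_lt_trans (perp_proj_le x.1) xr; rewrite (coordE _ _ kL).
  have : q1%:R ^+ 2 * eta <= k%:R ^+ 2 * eta.
    by rewrite ler_wpM2r// ler_pXn2r ?nnegrE ?ler0n// ler_nat.
  by rewrite /t -/(phi x) -pmulrn; move: (sqnorm2 (phi x)) => z; lra.
have [X Xlift] := choice lifts.
(* All these denominators lie between q1 and q0 + q1, and q0 < q1. *)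
have kB (i j : 'I_K) : i != j ->
    s (n.+1 + i)%N != s (n.+1 + j)%N /\ (s (n.+1 + i) < s (n.+1 + j) + q1)%N.
  move=> ij; have iK := ltn_ord i; have jK := ltn_ord j.
  have si_le : (s (n.+1 + i) <= q)%N.
    have [->|ne] := eqVneq (n.+1 + i)%N (n + K)%N; first by rewrite sn.
    by rewrite -sn; apply/ltnW/slt; lia.
  have sj_ge : (q1 <= s (n.+1 + j))%N.
    have [j0|j0] := posnP j; first by rewrite j0 addn0 s1.
    by rewrite -s1; apply/ltnW/slt; lia.
  split; last lia.
  have : (i < j)%N || (j < i)%N by rewrite -neq_ltn.
  by case/orP => ltij; [rewrite ltn_eqF|rewrite gtn_eqF] => //; apply: slt; lia.
have comb2 (i j : 'I_K) : a *~ ((s (n.+1 + i)%N)%:Z - (s (n.+1 + j)%N)%:Z) -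
    (X i - X j) \in L.
  have [Li _ _] := Xlift i; have [Lj _ _] := Xlift j.
  have -> : a *~ ((s (n.+1 + i)%N)%:Z - (s (n.+1 + j)%N)%:Z) - (X i - X j) =
      a *~ (s (n.+1 + i)%N)%:Z - X i - (a *~ (s (n.+1 + j)%N)%:Z - X j).
    rewrite mulrzBr !opprB addrACA [RHS]addrACA; congr (_ + _).
    by rewrite addrC.
  exact: rpredB.
have dist2 (i j : 'I_K) : dU (X i - X j).2 0 < r.
  by have [_ ui _] := Xlift i; have [_ uj _] := Xlift j; exact: umet0B.
exists t, (fun i => phi (X i)), (fun i => (s (n.+1 + i)%N)%:Z), q1%:Z; split.
- by move=> i; have [] := Xlift i.
- move=> i j ij; rewrite leNgt -phiB; apply/negP => lt.
  have ji : j != i by rewrite eq_sym.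
  have [ne lti] := kB _ _ ij; have [_ ltj] := kB _ _ ji.
  by case: (short _ _ (comb2 i j) (dist2 i j) lt) => ?; lia.
- by move=> i j /kB[? ?]; split; lia.
- move=> i j i' j'; rewrite -phiB -phiD -phiB -addrA => lt e.
  have -> : e = (s (n.+1 + i)%N)%:Z - (s (n.+1 + j)%N)%:Z +
      ((s (n.+1 + i')%N)%:Z - (s (n.+1 + j')%N)%:Z) by rewrite /e addrA.
  apply: short lt; last exact: umet0D.
  by have := rpredD (comb2 i j) (comb2 i' j'); rewrite addrACA -mulrzDr -opprD.
- by move=> m1 i /=; rewrite f20// ipC linear0l.
Qed.

End Returns.

(** * The gap inequality *)

(** A failure would give 2^m + 1 separated points: five in a plane or three on a line. *)
Lemma best_denom_gap (R : realType) (V : vectType R) (ip : {dot V for @idfun R})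
    (U : zmodType) (dU : U -> U -> R) (L : zmodClosed (V * U)%type)
    (alpha : {quot L}) (n q0 q1 q : nat) :
  invariant_ultrametric dU -> (eff_dim ip L = 1%N \/ eff_dim ip L = 2%N) ->
  (0 < n)%N -> best_denom ip dU alpha n q0 -> best_denom ip dU alpha n.+1 q1 ->
  best_denom ip dU alpha (n + 2 ^ eff_dim ip L + 1)%N q -> (q0 + q1 < q)%N.
Proof.
move=> ultra m12 n0 h0 h1; rewrite ltnNge => h; apply/negP => qle.
have m2 : (eff_dim ip L <= 2)%N by case: m12 => ->.
rewrite -addnA in h.
have K1 : (1 < 2 ^ eff_dim ip L + 1)%N by case: m12 => ->.
have [s [w [k [Q [ws wB kB alt flat]]]]] :=
  separated_lifts ultra m2 n0 h0 h1 h K1 qle.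
case: m12 => m; last first.
  have o (i : nat) (i5 : (i < 5)%N) : (i < 2 ^ eff_dim ip L + 1)%N by rewrite m.
  by apply: (no_five_points ws wB kB alt (i := Ordinal (o 0 isT))
    (a := Ordinal (o 1 isT)) (b := Ordinal (o 2 isT)) (d := Ordinal (o 3 isT))
    (e := Ordinal (o 4 isT))).
have o (i : nat) (i3 : (i < 3)%N) : (i < 2 ^ eff_dim ip L + 1)%N by rewrite m.
pose x i := (w i).1.
have {}flat i : (w i).2 = 0 by apply: flat; rewrite m.
have {}ws i : x i ^+ 2 < s by have := ws i; rewrite /sqnorm2 flat expr0n addr0.
have {}wB i j : i != j -> s <= (x i - x j) ^+ 2.
  by move/wB; rewrite /sqnorm2 /= !flat subrr expr0n addr0.
by apply: (@no_three_on_line _ (x (Ordinal (o 0 isT))) (x (Ordinal (o 1 isT)))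
  (x (Ordinal (o 2 isT))) s) => //; exact: wB.
Qed.

(** * The Euclidean plane and a discrete ultrametric *)

Section DotProduct.
Context {R : realType}.
Implicit Types u v : (R^o * R^o)%type.

Definition dot2 u v : R := u.1 * v.1 + u.2 * v.2.

Lemma dot2_bilinear : bilinear_for
  (GRing.Scale.Law.clone _ _ ( *%R ) _)
  (GRing.Scale.Law.clone _ _ (@idfun R \; *%R ) _) dot2.
Proof.
by split=> [u'|u] a x y; rewrite /dot2 /= /GRing.scale /=; ring.
Qed.

HB.instance Definition _ := bilinear_isBilinear.Build R
  (R^o * R^o)%type (R^o * R^o)%type R _ _ dot2 dot2_bilinear.

(** Symmetry in the shape of a hermitian form, whose sign exponent is [false]. *)
Lemma dot2C u v : dot2 u v = (-1) ^+ false * @idfun R (dot2 v u).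
Proof. by rewrite expr0 mul1r /dot2 /=; ring. Qed.

HB.instance Definition _ :=
  isHermitianSesquilinear.Build R (R^o * R^o)%type false (@idfun R) dot2 dot2C.

Lemma dot2_gt0 u : u != 0 -> 0 < dot2 u u.
Proof.
case: u => x y xy0; rewrite /dot2 /= -!expr2 lt_def addr_ge0 ?sqr_ge0// andbT.
by rewrite paddr_eq0 ?sqr_ge0// !sqrf_eq0.
Qed.

HB.instance Definition _ := isDotProduct.Build R (R^o * R^o)%type dot2 dot2_gt0.

Definition dotp : {dot (R^o * R^o)%type for @idfun R} := dot2.

End DotProduct.

Section DiscreteMetric.
Context {R : realType} {U : zmodType} (r : R).

Definition discrete_dist (u w : U) : R := if u == w then 0 else r.

Lemma discrete_ultrametric : 0 < r -> invariant_ultrametric discrete_dist.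
Proof.
move=> r0; rewrite /discrete_dist; split=> [u w|u w|u w|u x w|x u w].
- by case: ifP => // _; exact: ltW.
- by case: eqP => [->|uw]; split=> // r00; move: r0; rewrite r00 ltxx.
- by rewrite eq_sym.
- have [_|uw] := eqVneq u w.
    by rewrite le_max; case: ifP => _; rewrite ?lexx ?(ltW r0).
  have [ux|_] := eqVneq u x; last by rewrite le_max lexx.
  by rewrite -ux (negPf uw) le_max lexx orbT.
- by rewrite (inj_eq (addIr x)).
Qed.

End DiscreteMetric.

(** * The subgroups of the sharpness examples *)

Section ParityLattice.
Context {R : realType}.
Variables (e f : int * int).
Local Notation V := (R^o * R^o)%type.

(** One family for both dimensions: with e = 0 the real parts lie on a line. *)
Definition lattice_point (i j : int) : V * 'Z_2 :=
  (((e.1 * i + f.1 * j)%:~R, (e.2 * i + f.2 * j)%:~R), j%:~R).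

Definition parity_lattice (x : V * 'Z_2) : bool :=
  `[< exists i j, x = lattice_point i j >].

Lemma lattice_pointB i j i' j' :
  lattice_point i j - lattice_point i' j' = lattice_point (i - i') (j - j').
Proof.
rewrite /lattice_point; congr (_, _); last by rewrite /= rmorphB.
by congr (_, _); rewrite /= -rmorphB; congr (_%:~R); ring.
Qed.

Lemma parity_lattice_closed : zmod_closed parity_lattice.
Proof.
split=> [|x y /asboolP[i [j ->]] /asboolP[i' [j' ->]]]; apply/asboolP.
  by exists 0, 0; rewrite -(subrr (lattice_point 0 0)) lattice_pointB.
by exists (i - i'), (j - j'); exact: lattice_pointB.
Qed.

Definition parity_subgroup : zmodClosed (V * 'Z_2)%type :=
  HB.pack parity_lattice
    (GRing.isZmodClosed.Build _ parity_lattice parity_lattice_closed).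

Lemma mem_parity_subgroup x :
  reflect (exists i j, x = lattice_point i j) (x \in parity_subgroup).
Proof. exact: asboolP. Qed.


Lemma parity_cases (j : int) : exists h, j = 2 * h \/ j = 2 * h + 1.
Proof. by exists (j %/ 2)%Z; lia. Qed.

Lemma parity_even (h : int) : (2 * h)%:~R = 0 :> 'Z_2.
Proof.
rewrite intrM mulr_natl [_ *+ 2](_ : _ = 0)//.
by apply/val_inj; case: (h%:~R) => -[|[|]].
Qed.

Lemma parity_odd (h : int) : (2 * h + 1)%:~R = 1 :> 'Z_2.
Proof. by rewrite intrD parity_even add0r. Qed.

Lemma ipnorm_dotp (v : V) : ipnorm dotp v = Num.sqrt (v.1 ^+ 2 + v.2 ^+ 2).
Proof. by rewrite /ipnorm /= /dot2 !expr2. Qed.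

Lemma coord_le_ipnorm (v : V) :
  `|v.1| <= ipnorm dotp v /\ `|v.2| <= ipnorm dotp v.
Proof.
rewrite ipnorm_dotp.
by split; rewrite -sqrtr_sqr ler_wsqrtr// ?lerDl ?lerDr sqr_ge0.
Qed.

Lemma parity_lineality v : v \in lineality parity_subgroup -> v = 0.
Proof.
move=> /mem_lineality vL.
have intr_half (x : R) : (forall t, exists z : int, t * x = z%:~R) -> x = 0.
  move=> xz; apply/eqP; apply: contrapT => /negP x0.
  (* This multiple of x is 1/2, not an integer. *)
  have [z] := xz (2 * x)^-1; rewrite invfM mulrVK ?unitfE// => z2.
  have : (2 * z)%:~R = 1%:~R :> R by rewrite intrM -z2 mulfV ?pnatr_eq0.
  by move=> /eqP; rewrite eqr_int => /eqP; lia.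
case: v vL => [v1 v2] vL; congr (_, _); apply: intr_half => t.
  by case/mem_parity_subgroup: (vL t) => i [j [tv _ _]]; eexists; exact: tv.
by case/mem_parity_subgroup: (vL t) => i [j [_ tv _]]; eexists; exact: tv.
Qed.

Let ev : V := (e.1%:~R, e.2%:~R).
Let fv : V := (f.1%:~R, f.2%:~R).

(** The lineality space is trivial, so the projection is the identity. *)
Lemma parity_eff_span : eff_span dotp parity_subgroup = <<[:: ev; fv]>>%VS.
Proof.
have projE v : perp_proj dotp parity_subgroup v = v.
  have [_ /parity_lineality/eqP] := perp_projP dotp parity_subgroup v.
  by rewrite subr_eq0 => /eqP.
have pointE i j : (lattice_point i j).1 = i%:~R *: ev + j%:~R *: fv.
  have coord (x y : int) :
      (x * i + y * j)%:~R = i%:~R * x%:~R + j%:~R * y%:~R :> R.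
    by rewrite intrD !intrM; ring.
  by apply: injective_projections; exact: coord.
apply/eqP; rewrite eqEsubv; apply/andP; split.
  apply/subvP => x /mem_set_span[t tL]; apply/subvP/span_subvP => y.
  move=> /tL[a /mem_parity_subgroup[i [j ->]] ->]; rewrite projE pointE.
  by rewrite memvD// memvZ// memv_span// !inE eqxx ?orbT.
apply/span_subvP => y; rewrite !inE => /orP[] /eqP ->.
- rewrite -(_ : (lattice_point 1 0).1 = ev).
    rewrite -[X in X \in _]projE; apply: perp_proj_eff.
    by apply/mem_parity_subgroup; exists 1, 0.
  by rewrite pointE scale1r scale0r addr0.
- rewrite -(_ : (lattice_point 0 1).1 = fv).
    rewrite -[X in X \in _]projE; apply: perp_proj_eff.
    by apply/mem_parity_subgroup; exists 0, 1.
  by rewrite pointE scale1r scale0r add0r.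
Qed.

Variable r : R.
Hypothesis r0 : 0 < r.
Local Notation dU := (discrete_dist (U := 'Z_2) r).

Lemma parity_subgroup_discrete x y : x \in parity_subgroup ->
  y \in parity_subgroup -> `|x.1.1 - y.1.1| < 1 -> `|x.1.2 - y.1.2| < 1 ->
  x.2 = y.2 -> x = y.
Proof.
move=> /mem_parity_subgroup[i [j ->]] /mem_parity_subgroup[i' [j' ->]].
rewrite /lattice_point /= -!intrB -!intr_norm !(ltr_int R _ 1) => h1 h2 ->.
by congr ((_%:~R, _%:~R), _); lia.
Qed.

Lemma pnorm_lt_coord x c : pnorm dotp dU x < c -> c <= r ->
  [/\ `|x.1.1| < c, `|x.1.2| < c & x.2 = 0].
Proof.
rewrite gt_max => /andP[xc uc] cr; have [h1 h2] := coord_le_ipnorm x.1.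
split; [exact: le_lt_trans xc|exact: le_lt_trans xc|].
move: uc; rewrite /discrete_dist; case: eqP => // _ rc.
by move: (lt_le_trans rc cr); rewrite ltxx.
Qed.

(** The lattice point close to [a] is unique, so the same one approximates [a] to every
    precision. *)
Lemma parity_closed_subgroup : closed_subgroup dotp dU parity_subgroup.
Proof.
move=> a near.
(* Below r the parities agree; below 1/2 two approximations differ by less than 1 in each integer
   coordinate. *)
have [m [m0 mr m2]] : exists m, [/\ 0 < m, m <= r & m <= 2^-1].
  exists (Num.min (2^-1) r); split; last by rewrite ge_min lexx.
    by rewrite lt_min r0 andbT invr_gt0 ltr0n.
  by rewrite ge_min lexx orbT.
have [l lL al] := near _ m0; have [a1 a2 a3] := pnorm_lt_coord al mr.
have uniq_l c l' : 0 < c -> c <= m -> l' \in parity_subgroup ->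
    pnorm dotp dU (a - l') < c -> l' = l.
  move=> c0 cm l'L al'.
  have [b1 b2 b3] := pnorm_lt_coord al' (le_trans cm mr).
  have close (x y z : R) : `|x - y| < m -> `|x - z| < c -> `|z - y| < 1.
    move=> xy xz; rewrite -(subrK x z) -addrA (le_lt_trans (ler_normD _ _))//.
    by rewrite distrC; lra.
  apply: parity_subgroup_discrete => //;
    [exact: close a1 b1|exact: close a2 b2|].
  move: a3 b3 => /= /eqP; rewrite subr_eq0 => /eqP <- /eqP.
  by rewrite subr_eq0 => /eqP <-.
have small c : 0 < c -> c <= m -> pnorm dotp dU (a - l) < c.
  move=> c0 cm; have [l' l'L al'] := near _ c0.
  by rewrite -(uniq_l _ _ c0 cm l'L al').
suff -> : a = l by [].
have eq0 (x : R) : (forall c, 0 < c -> c <= m -> `|x| < c) -> x = 0.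
  move=> xc; apply/eqP; rewrite -normr_le0 leNgt; apply/negP => x0.
  have := xc (Num.min `|x| m); rewrite !lt_min x0 m0 ge_min lexx orbT ltxx.
  by move=> /(_ isT isT).
have e1 : (a - l).1.1 = 0.
  apply: eq0 => c c0 cm.
  by have [] := pnorm_lt_coord (small c c0 cm) (le_trans cm mr).
have e2 : (a - l).1.2 = 0.
  apply: eq0 => c c0 cm.
  by have [] := pnorm_lt_coord (small c c0 cm) (le_trans cm mr).
apply: subr0_eq; move: e1 e2 a3; case: (a - l) => [[x y] z] /=.
by move=> -> -> ->.
Qed.

End ParityLattice.

(** * Returns in the parity quotients *)

Section ParityReturns.
Local Open Scope quotient_scope.
Context {R : realType}.
Variables (e f t : int * int) (s : nat).
Local Notation V := (R^o * R^o)%type.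
Local Notation dU := (discrete_dist (U := 'Z_2) (s%:R : R)).
Local Notation L := (parity_subgroup (R := R) e f).

Definition parity_base : V * 'Z_2 := ((t.1%:~R, t.2%:~R), 0).

Definition parity_elt : {quot L} := \pi_{quot L} parity_base.

Local Notation rho := (return_dist dotp dU parity_elt).

(** The squared length of k t - (i e + j f), kept in [int] so that concrete cases are decided by
    integer arithmetic. *)
Definition sqdist (k i j : int) : int :=
  (k * t.1 - (e.1 * i + f.1 * j)) * (k * t.1 - (e.1 * i + f.1 * j)) +
  (k * t.2 - (e.2 * i + f.2 * j)) * (k * t.2 - (e.2 * i + f.2 * j)).

Lemma pnorm_lattice_point (k : nat) i j :
  pnorm dotp dU (parity_base *+ k - lattice_point e f i j) =
  Num.max (Num.sqrt (sqdist k i j)%:~R) (discrete_dist s%:R (0 : 'Z_2) j%:~R).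
Proof.
have mulrnE (x : R) : x *+ k = k%:R * x by rewrite mulr_natl.
have coord (x y : int) : (x%:~R *+ k - y%:~R) ^+ 2 =
    ((k%:Z * x - y) * (k%:Z * x - y))%:~R :> R.
  by rewrite mulrnE -expr2 rmorphXn /= intrB intrM.
have baseE : parity_base *+ k = ((t.1%:~R *+ k, t.2%:~R *+ k), 0).
  elim: (k) => [|n IH]; rewrite ?mulr0n// !mulrSr IH.
  by congr (_, _); rewrite addr0.
rewrite baseE /pnorm ipnorm_dotp; congr Num.max.
  by rewrite /sqdist intrD -!coord.
by rewrite /discrete_dist /= sub0r oppr_eq0 eq_sym.
Qed.

Lemma discrete_dist_even h : dU 0 (2 * h)%:~R = 0.
Proof. by rewrite /discrete_dist parity_even eqxx. Qed.

(** Writing s as a root lets all bounds be compared under the root. *)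
Lemma discrete_dist_odd h : dU 0 (2 * h + 1)%:~R = Num.sqrt (s%:Z * s%:Z)%:~R.
Proof.
by rewrite /discrete_dist parity_odd intrM -expr2 sqrtr_sqr ger0_norm ?ler0n.
Qed.

Lemma return_ge (k : nat) (c : int) :
  (forall i h : int, c <= sqdist k i (2 * h)) ->
  (forall i h : int, c <= sqdist k i (2 * h + 1) \/ c <= s%:Z * s%:Z) ->
  Num.sqrt c%:~R <= rho k.
Proof.
move=> even odd; apply: return_dist_ge => l /mem_parity_subgroup[i [j ->]].
rewrite pnorm_lattice_point le_max.
have [h [->|->]] := parity_cases j.
  by rewrite ler_wsqrtr// ler_int even.
rewrite discrete_dist_odd; apply/orP.
by have [?|?] := odd i h; [left|right]; rewrite ler_wsqrtr// ler_int.
Qed.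

Lemma return_le_even (k : nat) (c i h : int) :
  sqdist k i (2 * h) <= c -> rho k <= Num.sqrt c%:~R.
Proof.
move=> le.
have lL : lattice_point e f i (2 * h) \in L.
  by apply/mem_parity_subgroup; exists i, (2 * h).
apply: le_trans (return_dist_le dotp dU parity_base k lL) _.
rewrite pnorm_lattice_point discrete_dist_even ge_max sqrtr_ge0 andbT.
by rewrite ler_wsqrtr// ler_int.
Qed.

Lemma return_le_odd (k : nat) (c i h : int) :
  sqdist k i (2 * h + 1) <= c -> s%:Z * s%:Z <= c -> rho k <= Num.sqrt c%:~R.
Proof.
move=> le sc.
have lL : lattice_point e f i (2 * h + 1) \in L.
  by apply/mem_parity_subgroup; exists i, (2 * h + 1).
apply: le_trans (return_dist_le dotp dU parity_base k lL) _.
by rewrite pnorm_lattice_point discrete_dist_odd ge_max !ler_wsqrtr ?ler_int.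
Qed.

(** The two bounds at q pin its return to the root of c, so no p strictly between q and q' improves
    on it. *)
Lemma best_denom_step n q q' (c c' : int) : best_denom dotp dU parity_elt n q ->
  (q < q')%N -> 0 < c -> c' < c ->
  (forall p, (q <= p < q')%N -> Num.sqrt c%:~R <= rho p) ->
  rho q <= Num.sqrt c%:~R -> rho q' <= Num.sqrt c'%:~R ->
  best_denom dotp dU parity_elt n.+1 q'.
Proof.
move=> hq qq' c0 cc' lb ub ub'; apply: (best_denomS hq qq') => [|p qp].
  apply: le_lt_trans ub' _; apply: lt_le_trans (lb q _); last by rewrite leqnn.
  by rewrite ltr_sqrt ?ltr_int// (ltr_int R 0).
rewrite ltNge => /negP nle; rewrite leqNgt; apply/negP => pq'; apply: nle.
by apply: le_trans ub (lb p _); rewrite (ltnW qp).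
Qed.

End ParityReturns.

(** * The two explicit examples *)

(** Gives [lia] linear conditions; 49 exceeds every squared return needed below, at most 37. *)
Lemma sum_sq_bound (x y c : int) : x * x + y * y < c -> c <= 49 ->
  [/\ - 7%:Z < x, x < 7, - 7%:Z < y & y < 7].
Proof. by move=> ? ?; split; nia. Qed.

Lemma sum_sq_ge (x y c : int) : c <= 49 ->
  (- 7%:Z < x -> x < 7 -> - 7%:Z < y -> y < 7 -> c <= x * x + y * y) ->
  c <= x * x + y * y.
Proof.
move=> c49 xy; rewrite leNgt; apply/negP => lt.
by have [? ? ? ?] := sum_sq_bound lt c49; move: lt; rewrite ltNge xy.
Qed.

(* Every lattice vector other than the one given by i0, h0 is at distance at
   least 7, and that bound determines i0, h0 linearly. *)
Ltac only_short i0 h0 := let i := fresh in let h := fresh in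
  intros i h; apply: sum_sq_ge => //= ? ? ? ?;
  (have -> : i = i0 by lia); (have -> : h = h0 by lia); by [].

(** For e = 0 the distance does not depend on i, so only h is determined. *)
Ltac only_short_line h0 := let i := fresh in let h := fresh in
  intros i h; apply: sum_sq_ge => //= ? ? ? ?; (have -> : h = h0 by lia); lia.

Section Examples.
Variable R : realType.

Local Notation dU1 := (discrete_dist (U := 'Z_2) (5%:R : R)).
Local Notation alpha1 := (@parity_elt R (0, 0) (14, 0) (6, 0)).
Local Notation rho1 := (return_dist dotp dU1 alpha1).

Lemma best_denoms_line :
  [/\ best_denom dotp dU1 alpha1 2 2, best_denom dotp dU1 alpha1 3 4 &
      best_denom dotp dU1 alpha1 4 5].
Proof.
have ge1 : Num.sqrt 36%:~R <= rho1 1.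
  apply: (@return_ge _ _ _ _ 5); first by only_short_line (0 : int).
  (* No odd point is within 7, so the bounds on h are contradictory and its proposed value is
     arbitrary. *)
  by intros i h; left; move: i h; only_short_line (0 : int).
have ge2 : Num.sqrt 25%:~R <= rho1 2.
  (* Odd points cost at least r = 5 through the discrete component. *)
  by apply: (@return_ge _ _ _ _ 5) => [|? ?]; [only_short_line (0 : int)|right].
have ge3 : Num.sqrt 25%:~R <= rho1 3.
  by apply: (@return_ge _ _ _ _ 5) => [|? ?]; [only_short_line (0 : int)|right].
have ge4 : Num.sqrt 16%:~R <= rho1 4.
  by apply: (@return_ge _ _ _ _ 5) => [|? ?]; [only_short_line (1 : int)|right].
have le1 : rho1 1 <= Num.sqrt 36%:~R.
  by apply: (@return_le_even _ _ _ _ 5 _ _ 0 0).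
have le2 : rho1 2 <= Num.sqrt 25%:~R.
  by apply: (@return_le_odd _ _ _ _ 5 _ _ 0 0).
have le4 : rho1 4 <= Num.sqrt 16%:~R.
  by apply: (@return_le_even _ _ _ _ 5 _ _ 0 1).
have le5 : rho1 5 <= Num.sqrt 4%:~R.
  by apply: (@return_le_even _ _ _ _ 5 _ _ 0 1).
have b2 : best_denom dotp dU1 alpha1 2 2.
  apply: (@best_denom_step _ _ _ _ 5 1 1 2 36 25 (best_denom1 _ _ _) isT isT isT
    _ le1 le2) => p pq.
  have -> : p = 1%N by clear -pq; lia.
  exact: ge1.
have b3 : best_denom dotp dU1 alpha1 3 4.
  apply: (@best_denom_step _ _ _ _ 5 2 2 4 25 16 b2 isT isT isT
    _ le2 le4) => p pq.
  have [->|->] : p = 2%N \/ p = 3%N by clear -pq; lia.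
    exact: ge2.
  exact: ge3.
split; [exact: b2|exact: b3|].
apply: (@best_denom_step _ _ _ _ 5 3 4 5 16 4 b3 isT isT isT
    _ le4 le5) => p pq.
have -> : p = 4%N by clear -pq; lia.
exact: ge4.
Qed.

Local Notation dU2 := (discrete_dist (U := 'Z_2) (6%:R : R)).
Local Notation alpha2 := (@parity_elt R (-13, 5) (0, 13) (7, 20)).
Local Notation rho2 := (return_dist dotp dU2 alpha2).

Lemma best_denoms_plane :
  [/\ best_denom dotp dU2 alpha2 2 4, best_denom dotp dU2 alpha2 3 6 &
      best_denom dotp dU2 alpha2 6 9].
Proof.
(* 37, 36, 34, 25, 20 are the squared returns of 1, 4, 6, 7, 8; any p in between needs only the
   bound of the preceding denominator. *)
have ge1 : Num.sqrt 37%:~R <= rho2 1.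
  apply: (@return_ge _ _ _ _ 6); first by only_short (-1 : int) (1 : int).
  by intros i h; left; move: i h; only_short (-1 : int) (1 : int).
have ge2 : Num.sqrt 37%:~R <= rho2 2.
  apply: (@return_ge _ _ _ _ 6); first by only_short (-1 : int) (1 : int).
  (* The nearest odd point leaves the remainder (1, 6), of squared norm exactly 37. *)
  by intros i h; left; move: i h; only_short (-1 : int) (1 : int).
have ge3 : Num.sqrt 37%:~R <= rho2 3.
  apply: (@return_ge _ _ _ _ 6); first by only_short (-2 : int) (2 : int).
  by intros i h; left; move: i h; only_short (-2 : int) (2 : int).
have ge4 : Num.sqrt 36%:~R <= rho2 4.
  by apply: (@return_ge _ _ _ _ 6) => [|? ?];
    [only_short (-2 : int) (3 : int)|right].
have ge5 : Num.sqrt 36%:~R <= rho2 5.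
  by apply: (@return_ge _ _ _ _ 6) => [|? ?];
    [only_short (-3 : int) (4 : int)|right].
have ge6 : Num.sqrt 34%:~R <= rho2 6.
  by apply: (@return_ge _ _ _ _ 6) => [|? ?];
    [only_short (-3 : int) (5 : int)|right].
have ge7 : Num.sqrt 25%:~R <= rho2 7.
  by apply: (@return_ge _ _ _ _ 6) => [|? ?];
    [only_short (-4 : int) (6 : int)|right].
have ge8 : Num.sqrt 20%:~R <= rho2 8.
  by apply: (@return_ge _ _ _ _ 6) => [|? ?];
    [only_short (-4 : int) (7 : int)|right].
have le1 : rho2 1 <= Num.sqrt 37%:~R.
  by apply: (@return_le_even _ _ _ _ 6 _ _ (-1) 1).
have le4 : rho2 4 <= Num.sqrt 36%:~R.
  by apply: (@return_le_odd _ _ _ _ 6 _ _ (-2) 3).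
have le6 : rho2 6 <= Num.sqrt 34%:~R.
  by apply: (@return_le_even _ _ _ _ 6 _ _ (-3) 5).
have le7 : rho2 7 <= Num.sqrt 25%:~R.
  by apply: (@return_le_even _ _ _ _ 6 _ _ (-4) 6).
have le8 : rho2 8 <= Num.sqrt 20%:~R.
  by apply: (@return_le_even _ _ _ _ 6 _ _ (-4) 7).
have le9 : rho2 9 <= Num.sqrt 13%:~R.
  by apply: (@return_le_even _ _ _ _ 6 _ _ (-5) 8).
have b2 : best_denom dotp dU2 alpha2 2 4.
  apply: (@best_denom_step _ _ _ _ 6 1 1 4 37 36 (best_denom1 _ _ _) isT isT isT
    _ le1 le4) => p pq.
  have [->|[->|->]] : p = 1%N \/ p = 2%N \/ p = 3%N by clear -pq; lia.
  - exact: ge1.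
  - exact: ge2.
  - exact: ge3.
have b3 : best_denom dotp dU2 alpha2 3 6.
  apply: (@best_denom_step _ _ _ _ 6 2 4 6 36 34 b2 isT isT isT
    _ le4 le6) => p pq.
  have [->|->] : p = 4%N \/ p = 5%N by clear -pq; lia.
    exact: ge4.
  exact: ge5.
have b4 : best_denom dotp dU2 alpha2 4 7.
  apply: (@best_denom_step _ _ _ _ 6 3 6 7 34 25 b3 isT isT isT
    _ le6 le7) => p pq.
  have -> : p = 6%N by clear -pq; lia.
  exact: ge6.
have b5 : best_denom dotp dU2 alpha2 5 8.
  apply: (@best_denom_step _ _ _ _ 6 4 7 8 25 20 b4 isT isT isT
    _ le7 le8) => p pq.
  have -> : p = 7%N by clear -pq; lia.
  exact: ge7.
split; [exact: b2|exact: b3|].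
apply: (@best_denom_step _ _ _ _ 6 5 8 9 20 13 b5 isT isT isT
    _ le8 le9) => p pq.
have -> : p = 8%N by clear -pq; lia.
exact: ge8.
Qed.

Lemma eff_dim_line : eff_dim (@dotp R) (parity_subgroup (0, 0) (14, 0)) = 1%N.
Proof.
rewrite /eff_dim parity_eff_span span_cons span_seq1.
rewrite (_ : (0%:~R, 0%:~R) = 0)// -span_seq1 span_seq1 (_ : <[0]> = 0)%VS.
  by rewrite add0v dim_vline xpair_eqE /= intr_eq0.
by apply/eqP; rewrite -dimv_eq0 dim_vline eqxx.
Qed.

Lemma eff_dim_plane :
  eff_dim (@dotp R) (parity_subgroup (-13, 5) (0, 13)) = 2%N.
Proof.
rewrite /eff_dim parity_eff_span; apply/eqP.
rewrite -/(free _) free_cons span_seq1 seq1_free; apply/andP; split.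
  apply/negP => /vlineP[c [/eqP]].
  by rewrite /= scaler0 intr_eq0.
by rewrite xpair_eqE /= negb_and !intr_eq0 orbT.
Qed.

End Examples.

Theorem theorem3 (R : realType) :
  (forall (V : vectType R) (ip : {dot V for @idfun R})
      (U : zmodType) (dU : U -> U -> R) (L : zmodClosed (V * U)%type),
    (0 < \dim {:V})%N ->
    invariant_ultrametric dU ->
    closed_subgroup ip dU L ->
    (eff_dim ip L = 1%N \/ eff_dim ip L = 2%N) ->
    forall (alpha : {quot L}) (n q0 q1 q : nat),
      (0 < n)%N ->
      best_denom ip dU alpha n q0 ->
      best_denom ip dU alpha n.+1 q1 ->
      best_denom ip dU alpha (n + 2 ^ eff_dim ip L + 1)%N q ->
      (q0 + q1 < q)%N)
  /\
  (forall m : nat, m = 1%N \/ m = 2%N ->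
    exists (V : vectType R) (ip : {dot V for @idfun R})
      (U : zmodType) (dU : U -> U -> R) (L : zmodClosed (V * U)%type),
      [/\ (0 < \dim {:V})%N,
          invariant_ultrametric dU,
          closed_subgroup ip dU L,
          eff_dim ip L = m &
          exists (alpha : {quot L}) (n q0 q1 q : nat),
            [/\ (0 < n)%N,
                best_denom ip dU alpha n q0,
                best_denom ip dU alpha n.+1 q1,
                best_denom ip dU alpha (n + 2 ^ m)%N q &
                (q < q0 + q1)%N]]).
Proof.
split=> [V ip U dU L _ ultra _ m12 alpha n q0 q1 q|m].
  exact: best_denom_gap.
case=> ->; exists (R^o * R^o)%type, dotp, 'Z_2.
- exists (discrete_dist 5%:R), (parity_subgroup (0, 0) (14, 0)).
  split; [by rewrite dimvf|exact: discrete_ultrametric|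
    exact: parity_closed_subgroup|exact: eff_dim_line|].
  (* Here n = 2 and q_4 = 5 < 2 + 4. *)
  exists (parity_elt (0, 0) (14, 0) (6, 0)), 2%N, 2%N, 4%N, 5%N.
  by have [b2 b3 b4] := best_denoms_line R.
- exists (discrete_dist 6%:R), (parity_subgroup (-13, 5) (0, 13)).
  split; [by rewrite dimvf|exact: discrete_ultrametric|
    exact: parity_closed_subgroup|exact: eff_dim_plane|].
  (* Here n = 2 and q_6 = 9 < 4 + 6. *)
  exists (parity_elt (-13, 5) (0, 13) (7, 20)), 2%N, 4%N, 6%N, 9%N.
  by have [b2 b3 b6] := best_denoms_plane R.
Qed.
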